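(* For all $h,o,\gamma>0$, integers $r\ge2$ and $0<\mu\le1$ there is a constant $c_3$, depending only on $h,o,r,\mu,\gamma$, such that the following holds. Let $\Lambda$ be a finite lattice with $N$ sites carrying a quantum system $(H_\Lambda,C_\Lambda,O^{(1)}_\Lambda,O^{(2)}_\Lambda)$ which satisfies conditions i)–vi) of the context with constants $h,o,r,\mu,\gamma$, where $\Phi^{(0)}_\Lambda$ is a normalized ground state of $H_\Lambda$ which is also an eigenstate of $C_\Lambda$, and $E^{(0)}_\Lambda$ is the ground state energy. Then for each nonzero integer $M$ with $$\frac{M^2}{N}\le c_2:=\min\left\{\frac{\mu^2}{192\,r},\ \frac{o\mu}{\sqrt{24\gamma}}\right\}$$ one can find an eigenstate $\Phi^{(M)}_\Lambda$ of $H_\Lambda$ such that each $\Phi^{(M)}_\Lambda$ is orthogonal to $\Phi^{(0)}_\Lambda$, the states $\Phi^{(M)}_\Lambda$ with distinct $M$ are orthogonal to each other, and the energy eigenvalue $E^{(M)}_\Lambda$ of $\Phi^{(M)}_\Lambda$ satisfies $$E^{(M)}_\Lambda-E^{(0)}_\Lambda\le c_3\frac{M^2}{N}.$$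
   Context: Setting. $\Lambda$ is a finite set of $N$ sites; to each $x\in\Lambda$ is associated a finite-dimensional Hilbert space $\mathcal H_x$, and $\mathcal H_\Lambda=\bigotimes_{x\in\Lambda}\mathcal H_x$. $\|\cdot\|$ on operators is the operator norm. $H_\Lambda=\sum_{x\in\Lambda}h_x$ with each $h_x$ self-adjoint on $\mathcal H_\Lambda$. $C_\Lambda$ is a self-adjoint operator on $\mathcal H_\Lambda$ with $[H_\Lambda,C_\Lambda]=0$. The order operators are $O^{(\alpha)}_\Lambda=\sum_{x\in\Lambda}o^{(\alpha)}_x$, $\alpha=1,2$, with each $o^{(\alpha)}_x$ self-adjoint; they satisfy $[O^{(1)}_\Lambda,C_\Lambda]=-iO^{(2)}_\Lambda$ and $[O^{(2)}_\Lambda,C_\Lambda]=iO^{(1)}_\Lambda$. Conditions: i) $[o^{(\alpha)}_x,o^{(\beta)}_y]=0$ for $x\ne y$, $\alpha,\beta\in\{1,2\}$. ii) For each $x\in\Lambda$ there is a set $\mathcal S_x\subset\Lambda$ with at most $r$ sites ($r\ge2$) such that $[h_x,o^{(\alpha)}_y]=0$ for $\alpha=1,2$ unless $y\in\mathcal S_x$. iii) $\|h_x\|\le h$ and $\|o^{(\alpha)}_x\|\le o$ for all $x$, $\alpha=1,2$. iv) $(\Phi^{(0)}_\Lambda,(O^{(1)}_\Lambda)^2\Phi^{(0)}_\Lambda)=(\Phi^{(0)}_\Lambda,(O^{(2)}_\Lambda)^2\Phi^{(0)}_\Lambda)\ge(\mu oN)^2$. v) $[O^{(1)}_\Lambda,O^{(2)}_\Lambda]=i\gamma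 C_\Lambda$. vi) With $U_\Lambda=\exp[i(\pi/\sqrt\gamma)O^{(1)}_\Lambda]$, one has $U_\Lambda H_\Lambda U_\Lambda^{-1}=H_\Lambda$ and $U_\Lambda\Phi^{(0)}_\Lambda\propto\Phi^{(0)}_\Lambda$. *)

(* Defs.v *)
From HB Require Import structures.
From mathcomp Require Import all_boot all_order all_algebra complex.
From mathcomp Require Import all_classical all_reals all_analysis.

Set Implicit Arguments.
Unset Strict Implicit.
Unset Printing Implicit Defensive.

Import Order.TTheory GRing.Theory Num.Theory.
Import numFieldNormedType.Exports.

Local Open Scope classical_set_scope.
Local Open Scope ring_scope.
Local Open Scope complex_scope.
Local Open Scope sesquilinear_scope.

(* With an orthonormal basis chosen in each local Hilbert space of dimension
   [d x], the product vectors indexed by [config d] form an orthonormal basis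
   of the tensor product over [Lam].  Vectors and operators are then columns
   and matrices of size [tensor_dim d], indexed through [enum_rank]. *)
Definition config (Lam : finType) (d : Lam -> nat) : finType :=
  {dffun forall x : Lam, 'I_(d x)}.

Definition tensor_dim (Lam : finType) (d : Lam -> nat) : nat := #|config d|.

Section HilbertSpace.
Variables (R : realType) (n : nat).
Implicit Types (u v : 'cV[R[i]]_n) (A B : 'M[R[i]]_n).

(* Antilinear in the first argument. *)
Definition inner u v : R[i] := (u^t* *m v) 0 0.

Definition hnorm v : R := Num.sqrt (complex.Re (inner v v)).

Definition opnorm A : R :=
  sup [set hnorm (A *m v) | v in [set v | hnorm v <= 1]].

Definition commutator A B : 'M[R[i]]_n := A *m B - B *m A.

Definition mxexp A : 'M[R[i]]_n :=
  limn (series (fun k : nat => (k`!%:R)^-1 *: A ^+ k)).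

Definition eigenstate A (a : R[i]) v : Prop := v != 0 /\ A *m v = a *: v.

(* Meant for Hermitian [A], all of whose eigenvalues are real. *)
Definition ground_energy A (E : R) : Prop :=
  (exists v, eigenstate A E%:C v) /\
  (forall (E' : R) v, eigenstate A E'%:C v -> E <= E').

End HilbertSpace.

(* Main.v *)
(** Write A for O1 + i O2 and A' for its adjoint.  The half turn U maps C to -C,
so C Phi0 = 0, and A^M Phi0, A'^M Phi0 lie in the sectors C = M and C = -M.  Both
have energy at least E0, so each excess is at most their sum, which is a sum over
k + l = M - 1 of differences X - Y with
  X = < A'^k A^M Phi0, [H, A] A^l Phi0 >,
  Y = < A'^k Phi0, [H, A] A^l A'^M Phi0 >.
Going from X to Y takes M (M - 1) transpositions of an A with an A', which cost
[A, A'] = 2 gamma C, of size O(M) on the vectors involved, and M moves of a letter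
across the local terms of [H, A], which cost local double commutators.  As
O1, O2, C span su(2), the Casimir operator K = O1^2 + O2^2 + gamma C^2 commutes
with A and C, the norm of a word of length j applied to Phi0 is at most the
square root of < Phi0, K^j Phi0 >, and these moments grow by a factor of order N^2
by log-convexity and long-range order; < Phi0, K^M Phi0 > is at most twice the
squared norm of A^M Phi0.  Hence the excess is O(M^2 / N), and so is that of
one of the components of A^M Phi0 in the eigenspaces of H, all of which lie in
the sector C = M. *)

Require Import Defs.
From HB Require Import structures.
From mathcomp Require Import all_boot all_order all_algebra complex.
From mathcomp Require Import all_classical all_reals all_analysis.
From mathcomp Require Import ring lra zify.

Set Implicit Arguments.
Unset Strict Implicit.
Unset Printing Implicit Defensive.

Import Order.TTheory GRing.Theory Num.Theory.
Import numFieldNormedType.Exports.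

Local Open Scope ring_scope.
Local Open Scope complex_scope.

(** * The real part of the inner product, and operator bounds *)

Section RealForm.
Local Open Scope sesquilinear_scope.
Variables (R : realType) (n : nat).
Implicit Types (u v w : 'cV[R[i]]_n) (A B : 'M[R[i]]_n) (a b : R).

Lemma innerE u v : inner u v = \sum_i (u i 0)^* * v i 0.
Proof. by rewrite /inner mxE; apply: eq_bigr => i _; rewrite !mxE. Qed.

Lemma innerC u v : inner v u = (inner u v)^*.
Proof.
rewrite !innerE rmorph_sum; apply: eq_bigr => i _.
by rewrite rmorphM /= conjcK mulrC.
Qed.

Lemma inner_mulmx A u v : inner u (A *m v) = inner (A^t* *m u) v.
Proof. by rewrite /inner trmx_mul map_mxM trmxCK mulmxA. Qed.

Lemma innerZr (z : R[i]) u v : inner u (z *: v) = z * inner u v.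
Proof. by rewrite /inner -scalemxAr mxE. Qed.

Lemma innerDr u v w : inner u (v + w) = inner u v + inner u w.
Proof. by rewrite /inner mulmxDr mxE. Qed.

Lemma hermsymmxE A : A \is hermsymmx -> A^t* = A.
Proof. by move=> /is_hermitianmxP {2}->; rewrite expr0 scale1r. Qed.

Lemma trmxCD A B : (A + B)^t* = A^t* + B^t*.
Proof. by rewrite linearD map_mxD. Qed.

Lemma trmxCZ (z : R[i]) A : (z *: A)^t* = z^* *: A^t*.
Proof. by rewrite linearZ map_mxZ. Qed.

Lemma trmxCM A B : (A *m B)^t* = B^t* *m A^t*.
Proof. by rewrite trmx_mul map_mxM. Qed.

Lemma trmxC_sum (I : finType) (F : I -> 'M[R[i]]_n) :
  (\sum_x F x)^t* = \sum_x (F x)^t*.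
Proof. by rewrite linear_sum map_mx_sum. Qed.

(** The quantities to be estimated are real; this symmetric form gives the same squared norm as
    [inner] and keeps the estimates free of conjugations. *)
Definition rdot u v : R := complex.Re (inner u v).

Lemma rdotC u v : rdot u v = rdot v u.
Proof. by rewrite /rdot innerC; case: (inner v u). Qed.

Lemma rdotDr u v w : rdot u (v + w) = rdot u v + rdot u w.
Proof. by rewrite /rdot innerDr raddfD. Qed.

Lemma rdotZr a u v : rdot u (a%:C *: v) = a * rdot u v.
Proof. by rewrite /rdot innerZr; case: (inner u v) => x y /=; rewrite mul0r subr0. Qed.

Lemma rdotNr u v : rdot u (- v) = - rdot u v.
Proof. by rewrite -scaleN1r (_ : -1 = (-1)%:C) ?rdotZr ?mulN1r // rmorphN1. Qed.

Lemma rdotBr u v w : rdot u (v - w) = rdot u v - rdot u w.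
Proof. by rewrite rdotDr rdotNr. Qed.

Lemma rdotBl u v w : rdot (u - v) w = rdot u w - rdot v w.
Proof. by rewrite rdotC rdotBr !(rdotC w). Qed.

Lemma rdotDl u v w : rdot (u + v) w = rdot u w + rdot v w.
Proof. by rewrite rdotC rdotDr !(rdotC w). Qed.

Lemma rdotZl a u v : rdot (a%:C *: u) v = a * rdot u v.
Proof. by rewrite rdotC rdotZr rdotC. Qed.

Lemma rdot_sumr (I : Type) (r : seq I) u (F : I -> 'cV[R[i]]_n) :
  rdot u (\sum_(i <- r) F i) = \sum_(i <- r) rdot u (F i).
Proof.
elim/big_rec2: _ => [|i x y _ <-]; last by rewrite rdotDr.
by rewrite /rdot /inner mulmx0 mxE.
Qed.

Lemma rdot_adj A u v : rdot u (A *m v) = rdot (A^t* *m u) v.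
Proof. by rewrite /rdot inner_mulmx. Qed.

Lemma inner_sqr v :
  inner v v = (\sum_i (complex.Re (v i 0) ^+ 2 + complex.Im (v i 0) ^+ 2))%:C.
Proof.
rewrite innerE rmorph_sum; apply: eq_bigr => i _.
by case: (v i 0) => x y /=; apply/eqP; rewrite eq_complex /=; apply/andP; split; apply/eqP; ring.
Qed.

Lemma inner_rdot v : inner v v = (rdot v v)%:C.
Proof. by rewrite /rdot inner_sqr. Qed.

Lemma rdot_ge0 v : 0 <= rdot v v.
Proof.
by rewrite /rdot inner_sqr /= sumr_ge0 // => i _; rewrite addr_ge0 ?sqr_ge0.
Qed.

Lemma rdot_eq0 v : rdot v v = 0 -> v = 0.
Proof.
rewrite /rdot inner_sqr /= => /eqP.
rewrite psumr_eq0 => [/allP v0|i _]; last by rewrite addr_ge0 ?sqr_ge0.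
apply/colP => i; have := v0 i (mem_index_enum _); rewrite !mxE /=.
rewrite paddr_eq0 ?sqr_ge0 // !sqrf_eq0 => /andP[/eqP vx /eqP vy].
by apply/eqP; rewrite eq_complex vx vy /= !eqxx.
Qed.

Lemma rdot_gt0 v : v != 0 -> 0 < rdot v v.
Proof.
move=> v0; rewrite lt_neqAle rdot_ge0 andbT eq_sym.
by apply: contra_neq v0; apply: rdot_eq0.
Qed.

Lemma hnorm_ge0 v : 0 <= hnorm v.
Proof. exact: sqrtr_ge0. Qed.

Lemma sqr_hnorm v : hnorm v ^+ 2 = rdot v v.
Proof. by rewrite sqr_sqrtr // rdot_ge0. Qed.

Lemma hnormE v : hnorm v = Num.sqrt (rdot v v).
Proof. by []. Qed.

Lemma normr_rdot u v : `|rdot u v| <= hnorm u * hnorm v.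
Proof.
rewrite -(ler_pXn2r (_ : (0 < 2)%N)) // ?nnegrE ?mulr_ge0 ?hnorm_ge0 //.
rewrite exprMn real_normK ?num_real // !sqr_hnorm.
have [->|/rdot_gt0 v0] := eqVneq v 0.
  suff e x : rdot x 0 = 0 by rewrite !e expr0n mulr0.
  by rewrite /rdot /inner mulmx0 mxE.
(* Cauchy-Schwarz: the squared norm of this vector is [rdot v v] times the gap in the inequality. *)
have := rdot_ge0 ((rdot v v)%:C *: u - (rdot u v)%:C *: v).
rewrite rdotBr !rdotBl !rdotZr !rdotZl (rdotC v u).
set x := rdot u v in v0 *; set y := rdot u u; set z := rdot v v in v0 *.
rewrite [X in 0 <= X](_ : _ = z * (y * z - x ^+ 2)); last by ring.
by rewrite pmulr_rge0 // subr_ge0.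
Qed.

Lemma hnormD u v : hnorm (u + v) <= hnorm u + hnorm v.
Proof.
rewrite -(ler_pXn2r (_ : (0 < 2)%N)) // ?nnegrE ?addr_ge0 ?hnorm_ge0 //.
rewrite sqr_hnorm sqrrD !sqr_hnorm rdotDl !rdotDr (rdotC v u).
by have := le_trans (ler_norm _) (normr_rdot u v); lra.
Qed.

Lemma hnormZ (z : R[i]) v : hnorm (z *: v) = complex.Re `|z| * hnorm v.
Proof.
rewrite normc_def /= -sqrtrM ?addr_ge0 ?sqr_ge0 //; congr (Num.sqrt _).
rewrite innerZr innerC innerZr inner_rdot; case: z => x y /=; ring.
Qed.

(** Quantifying over vectors instead of using the supremum in [opnorm] lets bounds be added and
    multiplied directly. *)
Definition bounded_by A b := forall v, hnorm (A *m v) <= b * hnorm v.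

Lemma bounded_byD A B a b :
  bounded_by A a -> bounded_by B b -> bounded_by (A + B) (a + b).
Proof.
move=> hA hB v; rewrite mulmxDl mulrDl (le_trans (hnormD _ _)) //.
exact: lerD.
Qed.

Lemma bounded_byM A B a b : 0 <= a ->
  bounded_by A a -> bounded_by B b -> bounded_by (A *m B) (a * b).
Proof.
move=> a0 hA hB v; rewrite -mulmxA (le_trans (hA _)) // -mulrA.
exact: ler_wpM2l.
Qed.

Lemma bounded_byZ z A b :
  bounded_by A b -> bounded_by (z *: A) (complex.Re `|z| * b).
Proof.
move=> hA v; rewrite -scalemxAl hnormZ -mulrA ler_wpM2l //.
by rewrite normc_def sqrtr_ge0.
Qed.

Lemma bounded_byN A b : bounded_by A b -> bounded_by (- A) b.
Proof.
move=> /(bounded_byZ (-1)); rewrite scaleN1r normrN1 mul1r.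
exact.
Qed.

Lemma bounded_by_sum (I : Type) (r : seq I) (P : pred I) (F : I -> 'M[R[i]]_n)
    (f : I -> R) :
  (forall i, P i -> bounded_by (F i) (f i)) ->
  bounded_by (\sum_(i <- r | P i) F i) (\sum_(i <- r | P i) f i).
Proof.
move=> hF; elim/big_rec2: _ => [v|i x y Pi hx]; last exact/bounded_byD/hx/hF.
rewrite mul0mx mul0r le_eqVlt; apply/orP; left.
by rewrite hnormE /rdot /inner mulmx0 mxE sqrtr0.
Qed.

Lemma bounded_by_commutator A B a b : 0 <= a -> 0 <= b ->
  bounded_by A a -> bounded_by B b -> bounded_by (commutator A B) (2 * a * b).
Proof.
move=> a0 b0 hA hB; rewrite (_ : 2 * a * b = a * b + b * a); last by ring.
by apply: bounded_byD; last apply: bounded_byN; apply: bounded_byM.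
Qed.

(** Finite dimension enters here: [A] is a finite combination of matrix units, which are
    contractions. Hence the supremum in [opnorm] is over a bounded set. *)
Lemma bounded_by_ex A : exists b, bounded_by A b.
Proof.
suff hd i j : bounded_by (delta_mx i j) 1.
  exists (\sum_i \sum_j complex.Re `|A i j| * 1).
  rewrite {1}[A]matrix_sum_delta.
  by do 2![apply: bounded_by_sum => ? _]; apply: bounded_byZ.
move=> v; rewrite mul1r ler_sqrt ?rdot_ge0 // !inner_sqr /=.
rewrite (bigD1 i) //= big1 ?addr0; last first.
  move=> k ki; rewrite mxE big1 /= ?expr0n ?addr0 // => l _.
  by rewrite mxE (negPf ki) mul0r.
rewrite (bigD1 j) //= mxE (bigD1 j) //= mxE !eqxx mul1r big1 ?addr0.
  by rewrite lerDl sumr_ge0 // => k _; rewrite addr_ge0 ?sqr_ge0.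
by move=> k kj; rewrite mxE (negPf kj) andbF mul0r.
Qed.

Lemma opnorm_bounded A b : opnorm A <= b -> bounded_by A b.
Proof.
(* A vector of norm zero cannot be normalized; any bound on [A] settles that case. *)
move=> Ab v; have [v0|v0] := eqVneq (hnorm v) 0.
  have [c /(_ v)] := bounded_by_ex A.
  by rewrite v0 !mulr0.
have vp : 0 < hnorm v by rewrite lt_neqAle eq_sym v0 hnorm_ge0.
rewrite -ler_pdivrMr //; apply: le_trans Ab.
apply: ub_le_sup.
  have [c hc] := bounded_by_ex A; exists `|c| => _ [u /= u1 <-].
  apply: le_trans (hc _) (le_trans (_ : _ <= `|c| * hnorm u) _).
    by rewrite ler_wpM2r ?hnorm_ge0 ?ler_norm.
  by rewrite ler_piMr.
have e : complex.Re `|(hnorm v)^-1%:C| = (hnorm v)^-1.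
  by rewrite normc_def /= expr0n addr0 sqrtr_sqr ger0_norm ?invr_ge0 ?hnorm_ge0.
exists ((hnorm v)^-1%:C *: v).
  by rewrite /= hnormZ e mulVf.
by rewrite -scalemxAr hnormZ e mulrC.
Qed.

End RealForm.

(** * Rayleigh quotients *)

Section Spectral.
Local Open Scope sesquilinear_scope.
Variables (R : realType) (n : nat).
Implicit Types (H C O : 'M[R[i]]_n) (v psi : 'cV[R[i]]_n).

Lemma hermsymmx_diag H : H \is hermsymmx ->
  exists (P : 'M[R[i]]_n) (d : 'I_n -> R),
    [/\ P^t* *m P = 1%:M, P *m P^t* = 1%:M &
        H = P^t* *m diag_mx (\row_j (d j)%:C) *m P].
Proof.
move=> hH; have PU := spectral_unitarymx H.
have Pi := invmx_unitary PU.
exists (spectralmx H), (fun j => complex.Re (spectral_diag H 0 j)); split.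
- by rewrite -Pi mulVmx // unitarymx_unit.
- exact/unitarymxP.
have /hermitian_normalmx/orthomx_spectralP {1}-> := hH.
rewrite -Pi (_ : \row_j _ = spectral_diag H) //; apply/rowP => j; rewrite mxE.
exact/RRe_real/(mxOverP (hermitian_spectral_diag_real hH)).
Qed.

Lemma mul_diagmxE (d : 'rV[R[i]]_n) (A : 'M[R[i]]_n) j k :
  (diag_mx d *m A) j k = d 0 j * A j k.
Proof. by rewrite mul_diag_mx mxE. Qed.

Lemma mul_mx_diagE (d : 'rV[R[i]]_n) (A : 'M[R[i]]_n) j k :
  (A *m diag_mx d) j k = A j k * d 0 k.
Proof. by rewrite mul_mx_diag mxE. Qed.

Lemma mul_diagcvE (d : 'rV[R[i]]_n) v j : (diag_mx d *m v) j 0 = d 0 j * v j 0.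
Proof. by rewrite mul_diag_mx mxE. Qed.

Lemma rdotE (u v : 'cV[R[i]]_n) :
  rdot u v = \sum_j complex.Re ((u j 0)^* * v j 0).
Proof. by rewrite /rdot innerE raddf_sum. Qed.

(* Projecting [psi] onto an eigenspace of [H] preserves the sector of [C]. *)
Lemma rayleigh_eigenstate H C (m : R[i]) psi :
  H \is hermsymmx -> commutator H C = 0 -> psi != 0 -> C *m psi = m *: psi ->
  exists (E : R) v,
    [/\ eigenstate H E%:C v, C *m v = m *: v &
        E * rdot psi psi <= rdot psi (H *m psi)].
Proof.
move=> /hermsymmx_diag [P [d [PP PP' HE]]] HC psi0 Cpsi.
set D := diag_mx _ in HE.
have [phi phiE] : exists phi, phi = P *m psi by exists (P *m psi).
have psiE : psi = P^t* *m phi by rewrite phiE mulmxA PP mul1mx.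
have phi0 : phi != 0 by apply: contra_neq psi0; rewrite psiE => ->; rewrite mulmx0.
have psiphi : rdot psi psi = rdot phi phi.
  by rewrite phiE rdot_adj mulmxA PP mul1mx.
have HpsiE : rdot psi (H *m psi) = rdot phi (D *m phi).
  by rewrite HE -!mulmxA rdot_adj trmxCK phiE.
(* The Rayleigh quotient is the mean of the [d j] weighted by the squared moduli of the [phi j 0],
   so some eigenvalue of nonzero weight does not exceed it. *)
have [j [phij dj]] : exists j, phi j 0 != 0 /\
    d j * rdot psi psi <= rdot psi (H *m psi).
  apply: contrapT => no.
  have hj j : phi j 0 != 0 -> rdot phi (D *m phi) < d j * rdot phi phi.
    move=> phij; rewrite ltNge; apply/negP => le.
    by apply: no; exists j; rewrite psiphi HpsiE.
  have pp : 0 < rdot phi phi by apply: rdot_gt0.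
  pose rho := rdot phi (D *m phi) / rdot phi phi.
  have rhoE : rdot phi (D *m phi) = rho * rdot phi phi by rewrite divfK // gt_eqF.
  suff : rho * rdot phi phi < rdot phi (D *m phi) by rewrite -rhoE ltxx.
  rewrite !rdotE mulr_sumr.
  have sq j : complex.Re ((phi j 0)^* * (D *m phi) j 0) =
      d j * complex.Re ((phi j 0)^* * phi j 0).
    rewrite mul_diagcvE; move: (phi j 0) => [x y]; rewrite mxE /=; ring.
  have ge0 j : 0 <= complex.Re ((phi j 0)^* * phi j 0).
    by case: (phi j 0) => x y /=; rewrite mulNr opprK addr_ge0 // -expr2 sqr_ge0.
  have rhod j : phi j 0 != 0 -> rho < d j.
    by move=> /hj; rewrite rhoE ltr_pM2r.
  have [j phij] : exists j, phi j 0 != 0.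
    apply: contrapT => no'; case/eqP: phi0; apply/colP => j; rewrite mxE.
    by apply/eqP/negPn/negP => phij; apply: no'; exists j.
  rewrite [ltLHS](bigD1 j) //= [ltRHS](bigD1 j) //=; apply: ltr_leD.
    rewrite sq ltr_pM2r ?rhod //.
    rewrite lt_neqAle ge0 andbT eq_sym; apply: contra phij.
    case: (phi j 0) => x y /=; rewrite mulNr opprK.
    rewrite paddr_eq0 -?expr2 ?sqr_ge0 // !sqrf_eq0 => /andP[/eqP-> /eqP->].
    by [].
  apply: ler_sum => k _; rewrite sq.
  have [->|phik] := eqVneq (phi k 0) 0; first by rewrite mulr0 /= !mulr0.
  by rewrite ler_wpM2r // ltW ?rhod.
(* Projection onto the whole eigenspace for [d j], not onto coordinate [j] alone: it then commutes
   with [C'], whose entries between distinct eigenvalues vanish. *)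
pose Pi := diag_mx (\row_k (d k == d j)%:R : 'rV[R[i]]_n).
have [C' C'E] : exists C', C' = P *m C *m P^t* by exists (P *m C *m P^t* ).
have CE : C = P^t* *m C' *m P.
  by rewrite C'E !mulmxA PP mul1mx -mulmxA PP mulmx1.
have mulE A B : P^t* *m A *m P *m (P^t* *m B *m P) = P^t* *m (A *m B) *m P.
  by rewrite -!mulmxA (mulmxA P) PP' mul1mx.
have DC : D *m C' = C' *m D.
  have : H *m C = C *m H by apply/eqP; rewrite -subr_eq0; apply/eqP.
  have inj A B : P^t* *m A *m P = P^t* *m B *m P -> A = B.
    move=> /(congr1 (fun X => P *m X *m P^t* )).
    by rewrite -!mulmxA PP' !mulmx1 !(mulmxA P) PP' !mul1mx.
  by rewrite HE CE !mulE => /inj.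
have PiC : Pi *m C' = C' *m Pi.
  apply/matrixP => k l; rewrite mul_diagmxE mul_mx_diagE !mxE.
  have := congr1 (fun X : 'M[R[i]]_n => X k l) DC.
  rewrite /D mul_diagmxE mul_mx_diagE !mxE.
  have [-> _|Ckl] := eqVneq (C' k l) 0; first by rewrite mulr0 mul0r.
  by rewrite mulrC => /(mulfI Ckl)/complexI ->; rewrite mulrC.
exists (d j), (P^t* *m Pi *m phi); split => //.
- split.
    apply/eqP => /(congr1 (mulmx P)).
    rewrite !mulmxA PP' mul1mx mulmx0 => /colP/(_ j); rewrite mul_diagcvE !mxE.
    by rewrite eqxx mul1r; apply/eqP.
  rewrite HE -!mulmxA (mulmxA P) PP' mul1mx scalemxAr; congr (_ *m _).
  apply/colP => k; rewrite mul_diagcvE [in RHS]mxE !mul_diagcvE !mxE.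
  by have [->|] := eqVneq (d k) (d j) => //; rewrite !(mul0r, mulr0).
- have C'phi : C' *m phi = m *: phi.
    by rewrite C'E phiE -!mulmxA (mulmxA (P^t* ) P) PP mul1mx Cpsi scalemxAr.
  rewrite CE -!mulmxA (mulmxA P) PP' mul1mx (mulmxA C') -PiC -mulmxA C'phi.
  by rewrite -!scalemxAr.
Qed.

(** The variational principle, from [rayleigh_eigenstate] with the zero operator as a trivial
    symmetry. *)
Lemma ground_energy_le H (E0 : R) psi :
  H \is hermsymmx -> ground_energy H E0 ->
  E0 * rdot psi psi <= rdot psi (H *m psi).
Proof.
move=> hH [_ minE]; have [->|psi0] := eqVneq psi 0.
  by rewrite mulmx0 /rdot /inner mulmx0 mxE mulr0.
have [||E [v [Ev _ le]]] := @rayleigh_eigenstate H 0 0 psi hH _ psi0 _.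
- by rewrite /commutator mulmx0 mul0mx subr0.
- by rewrite mul0mx scale0r.
apply: le_trans le; rewrite ler_wpM2r ?rdot_ge0 //.
exact: minE Ev.
Qed.

End Spectral.

(** * The half turn generated by the first order operator *)

Section HalfTurn.
Local Open Scope sesquilinear_scope.
Variable R : realType.
Let K : numFieldType := R[i].

Definition expi (x : R) : R[i] := cos x +i* sin x.

Lemma expiDpi x : expi (x + pi) = - expi x.
Proof. by rewrite /expi cosDpi sinDpi. Qed.

Lemma expiBpi x : expi (x - pi) = - expi x.
Proof. by rewrite -{2}[x](subrK pi) expiDpi opprK. Qed.

Lemma expi_neq0 x : expi x != 0.
Proof.
apply/negP => /eqP e; have := cos2Dsin2 x.
have -> : cos x = 0 by have := congr1 (@complex.Re R) e.
have -> : sin x = 0 by have := congr1 (@complex.Im R) e.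
by rewrite expr0n /= addr0 => /eqP; rewrite eq_sym oner_eq0.
Qed.

Lemma cvg_real_complex (u : nat -> R) (l : R) :
  (u @ \oo --> l -> (fun k => (u k)%:C : K) @ \oo --> (l%:C : K))%classic.
Proof.
move=> /cvgrPdist_lt ul; apply/cvgrPdist_lt => -[e e'].
(* Positivity in [R[i]] forces the tolerance to be real. *)
rewrite ltcE /= => /andP[/eqP -> e0].
near=> k; rewrite -rmorphB normc_def /= expr0n addr0 sqrtr_sqr ltcR.
by near: k; apply: ul.
Unshelve. all: by end_near. Qed.

Lemma exp_coeff_expi (x : R) k :
  (k`!%:R)^-1 * (0 +i* x) ^+ k = cos_coeff x k +i* sin_coeff x k :> R[i].
Proof.
have ek : (k`!%:R)^-1 = (k`!%:R^-1)%:C :> R[i] by rewrite fmorphV rmorph_nat.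
rewrite ek /cos_coeff /sin_coeff /=.
have sq : (0 +i* x) ^+ 2 = - (x ^+ 2)%:C :> R[i].
  by rewrite expr2; apply/eqP; rewrite eq_complex /=; apply/andP; split; apply/eqP; ring.
have hX m : (0 +i* x) ^+ m.*2 = ((-1) ^+ m * x ^+ m.*2)%:C :> R[i].
  by rewrite -mul2n exprM sq -rmorphN -rmorphXn /= [in LHS]exprNn exprM.
rewrite -exprnP; have := odd_double_half k; case: (odd k) => /= <-.
  rewrite add1n /= uphalf_double doubleK exprS hX exprS.
  by apply/eqP; rewrite eq_complex /=; apply/andP; split; apply/eqP; ring.
rewrite add0n doubleK hX.
by apply/eqP; rewrite eq_complex /=; apply/andP; split; apply/eqP; ring.
Qed.

Lemma cvg_series_expi (x : R) :
  (series (fun k => (k`!%:R)^-1 * (0 +i* x) ^+ k : K) @ \oo --> (expi x : K))%classic.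
Proof.
have e (z : R[i]) : z = (complex.Re z)%:C + (0 +i* 1) * (complex.Im z)%:C.
  by rewrite [LHS]complexE.
rewrite (_ : series _ = fun N => (series (cos_coeff x) N)%:C
    + (0 +i* 1) * (series (sin_coeff x) N)%:C); last first.
  apply/funext => N; rewrite /series /= !rmorph_sum mulr_sumr -big_split /=.
  by apply: eq_bigr => k _; rewrite exp_coeff_expi [LHS]e.
rewrite [expi x]e; apply: cvgD; first apply: cvg_real_complex.
  rewrite /= cos.unlock; exact: is_cvg_series_cos_coeff.
apply: cvgMl_tmp; apply: cvg_real_complex.
rewrite /= sin.unlock; exact: is_cvg_series_sin_coeff.
Qed.

Variable n : nat.
Implicit Types (O C : 'M[R[i]]_n) (v psi : 'cV[R[i]]_n).

Lemma mxexp_diag (P : 'M[R[i]]_n) (d : 'I_n -> R) (x : R) :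
  P *m P^t* = 1%:M -> P^t* *m P = 1%:M ->
  mxexp ((0 +i* x) *: (P^t* *m diag_mx (\row_j (d j)%:C) *m P)) =
  P^t* *m diag_mx (\row_j expi (x * d j)) *m P.
Proof.
move=> PP' PP.
(* With the rank-one spectral projections the matrix series becomes a finite sum of scalar series,
   whose limits are known. *)
pose Q j := P^t* *m delta_mx j j *m P : 'M[R[i]]_n.
have diagE (f : 'I_n -> R[i]) :
    P^t* *m diag_mx (\row_j f j) *m P = \sum_j f j *: Q j.
  rewrite diag_mx_sum_delta mulmx_sumr mulmx_suml.
  by apply: eq_bigr => j _; rewrite mxE -scalemxAr -scalemxAl.
have powE k : ((0 +i* x) *: (P^t* *m diag_mx (\row_j (d j)%:C) *m P)) ^+ k =
    P^t* *m diag_mx (\row_j ((0 +i* (x * d j)) ^+ k)) *m P.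
  elim: k => [|k IHk].
    rewrite expr0 (_ : \row_j _ = const_mx 1) ?diag_const_mx ?mulmx1 ?PP //.
    by apply/rowP => j; rewrite !mxE expr0.
  rewrite exprS IHk -[LHS]/(_ *m _) -scalemxAl -!mulmxA (mulmxA P) PP' mul1mx.
  rewrite scalemxAr; congr (_ *m _); rewrite mulmxA scalemxAl; congr (_ *m _).
  rewrite mulmx_diag; apply/matrixP => a b; rewrite !mxE exprS.
  rewrite mulrnAr mulrA; congr (_ * _ *+ _).
  by apply/eqP; rewrite eq_complex /=; apply/andP; split; apply/eqP; ring.
rewrite diagE /mxexp; apply: (@cvg_lim 'M[K]_n); first exact: norm_hausdorff.
rewrite (_ : series _ = fun N => \sum_j
    (series (fun k => (k`!%:R)^-1 * (0 +i* (x * d j)) ^+ k : R[i]) N) *: Q j).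
  apply: cvg_big => [|j _]; first exact: add_continuous.
  apply: cvgZr_tmp; exact: cvg_series_expi.
apply/funext => N; rewrite /series /=.
under [RHS]eq_bigr do rewrite scaler_suml.
rewrite exchange_big; apply: eq_bigr => k _ /=.
by rewrite powE diagE scaler_sumr; apply: eq_bigr => j _; rewrite scalerA.
Qed.

(* In an eigenbasis of [O], a nonzero entry of [C] joins eigenvalues that differ
   by [sqrt gamma], whose phases under the half turn are opposite, whereas
   [psi] only charges eigenvalues with one and the same phase. *)
Lemma half_turn_eigenvalue0 O C psi (gamma : R) (c z : R[i]) :
  0 < gamma -> O \is hermsymmx ->
  commutator O (commutator O C) = gamma%:C *: C ->
  mxexp ((0 +i* (pi / Num.sqrt gamma)) *: O) *m psi = z *: psi ->
  psi != 0 -> C *m psi = c *: psi -> c = 0.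
Proof.
move=> g0 /hermsymmx_diag [P [d [PP PP' OE]]].
set x := pi / _; set D := diag_mx _ in OE.
have [phi phiE] : exists phi, phi = P *m psi by exists (P *m psi).
have [C' C'E0] : exists C', C' = P *m C *m P^t* by exists (P *m C *m P^t* ).
have CE : C = P^t* *m C' *m P.
  by rewrite C'E0 !mulmxA PP mul1mx -mulmxA PP mulmx1.
move=> OOC + psi0 Cpsi; rewrite OE mxexp_diag // => Upsi.
(* Entrywise in the eigenbasis, the double commutator multiplies [C' j k] by [(d j - d k) ^+ 2]. *)
have C'E j k : (d j - d k) ^+ 2 != gamma -> C' j k = 0.
  have comE A B : commutator (P^t* *m A *m P) (P^t* *m B *m P) =
      P^t* *m commutator A B *m P.
    have mulE X Y : P^t* *m X *m P *m (P^t* *m Y *m P) = P^t* *m (X *m Y) *m P.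
      by rewrite -!mulmxA (mulmxA P) PP' mul1mx.
    by rewrite /commutator !mulE mulmxBr mulmxBl.
  have inj A B : P^t* *m A *m P = P^t* *m B *m P -> A = B.
    move=> /(congr1 (fun X => P *m X *m P^t* )).
    by rewrite -!mulmxA PP' !mulmx1 !(mulmxA P) PP' !mul1mx.
  move: OOC; rewrite OE CE !comE scalemxAl scalemxAr => /inj /matrixP/(_ j k).
  have comD X l m : commutator D X l m = (d l - d m)%:C * X l m.
    rewrite mxE mul_diagmxE [X in _ + X]mxE mul_mx_diagE !mxE.
    by rewrite rmorphB mulrBl [X l m * _]mulrC.
  rewrite !comD mulrA -rmorphM -expr2 mxE => /eqP.
  rewrite -subr_eq0 -mulrBl -rmorphB => /eqP e.
  move=> ne; move/eqP: e; rewrite mulf_eq0 => /orP[|/eqP//].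
  by rewrite -[0]/(0%:C) => /eqP/complexI/eqP; rewrite subr_eq0 (negPf ne).
have Dphi j : expi (x * d j) * phi j 0 = z * phi j 0.
  have := congr1 (fun X => P *m X) Upsi; rewrite -!mulmxA (mulmxA P) PP' mul1mx.
  by rewrite -scalemxAr -phiE => /colP/(_ j); rewrite mul_diagcvE !mxE.
have C'phi : C' *m phi = c *: phi.
  by rewrite C'E0 phiE -!mulmxA (mulmxA (P^t* ) P) PP mul1mx Cpsi scalemxAr.
have [j phij] : exists j, phi j 0 != 0.
  apply: contrapT => no; case/eqP: psi0.
  rewrite (_ : psi = P^t* *m phi); last by rewrite phiE mulmxA PP mul1mx.
  rewrite (_ : phi = 0) ?mulmx0 //; apply/colP => j; rewrite mxE.
  by apply/eqP/negPn/negP => phij; apply: no; exists j.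
(* Coordinate [j] of [C' *m phi = c *: phi], with [phi j 0 != 0]: it suffices that each term of the
   sum on the left vanishes. *)
have := congr1 (fun X : 'cV[R[i]]_n => X j 0) C'phi; rewrite /= !mxE big1 => [/esym/eqP|k _].
  by rewrite mulf_eq0 (negPf phij) orbF => /eqP.
have [->|phik] := eqVneq (phi k 0) 0; first by rewrite mulr0.
have [jk|] := eqVneq ((d j - d k) ^+ 2) gamma; last by move/C'E ->; rewrite mul0r.
have zj : expi (x * d j) = z by apply: (mulIf phij); rewrite Dphi.
have zk : expi (x * d k) = z by apply: (mulIf phik); rewrite Dphi.
have sg : 0 < Num.sqrt gamma by rewrite sqrtr_gt0.
have dd : (d j - d k - Num.sqrt gamma) * (d j - d k + Num.sqrt gamma) = 0.
  by rewrite -subr_sqr sqr_sqrtr ?ltW // jk subrr.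
have xg : x * Num.sqrt gamma = pi by rewrite /x divfK // gt_eqF.
suff : expi (x * d j) = - expi (x * d k).
  by rewrite zj zk => /eqP; rewrite -addr_eq0 -mulr2n mulrn_eq0 -zj (negPf (expi_neq0 _)).
move/eqP: dd; rewrite mulf_eq0 => /orP[]; rewrite ?subr_eq0 ?addr_eq0 => /eqP e.
  by rewrite -expiDpi -xg -mulrDr -e addrC subrK.
by rewrite -expiBpi -xg -mulrBr -e addrC subrK.
Qed.

End HalfTurn.

(** * Ladder operators and moments of the Casimir operator *)

Section Words.
Variables (R : realType) (n : nat) (A : bool -> 'M[R[i]]_n).

(** The head of the word acts last. *)
Definition act (w : seq bool) (v : 'cV[R[i]]_n) : 'cV[R[i]]_n :=
  foldr (fun b => mulmx (A b)) v w.

Lemma act_cat w1 w2 v : act (w1 ++ w2) v = act w1 (act w2 v).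
Proof. exact: foldr_cat. Qed.

Lemma actB w v1 v2 : act w (v1 - v2) = act w v1 - act w v2.
Proof. by elim: w => // b w /= ->; rewrite mulmxBr. Qed.

Lemma actZ w (a : R[i]) v : act w (a *: v) = a *: act w v.
Proof. by elim: w => // b w /= ->; rewrite scalemxAr. Qed.

End Words.

(** The charge of a word: its eigenvalue under [C] when applied to a vector killed by [C]. *)
Definition weight (w : seq bool) : int :=
  \sum_(b <- w) (if b then 1 else - 1).

Lemma weight_cons b w : weight (b :: w) = (if b then 1 else - 1) + weight w.
Proof. by rewrite /weight big_cons. Qed.

Lemma normr_weight w : `|weight w| <= (size w)%:Z.
Proof.
elim: w => [|b w IHw]; first by rewrite /weight big_nil.
by rewrite weight_cons /=; case: b; lia.
Qed.

Lemma weight_nseq k b : weight (nseq k b) = if b then k%:Z else - k%:Z.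
Proof.
elim: k => [|k IHk]; first by rewrite /weight big_nil; case: b.
by rewrite /= weight_cons IHk; case: b {IHk}; lia.
Qed.

Ltac mx_entries := apply/matrixP => ? ?; rewrite !mxE;
  repeat match goal with
  | |- context [fun_of_matrix ?A ?j ?k] => move: (fun_of_matrix A j k) => ?
  end.

Section Ladder.
Local Open Scope sesquilinear_scope.
Variables (R : realType) (n : nat) (O1 O2 C : 'M[R[i]]_n) (gamma : R).

Definition ladder_sign (b : bool) : R := if b then 1 else -1.

(** Under the hypotheses below, [ladder true] raises the eigenvalue of [C] by one and
    [ladder false], its adjoint, lowers it. *)
Definition ladder (b : bool) : 'M[R[i]]_n := O1 + (0 +i* ladder_sign b) *: O2.

(** The factor [gamma] appears because [O1], [O2] and [sqrt gamma] times [C] satisfy the rotation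
    relations with one common constant. *)
Definition casimir : 'M[R[i]]_n := O1 *m O1 + O2 *m O2 + gamma%:C *: (C *m C).

Hypothesis O1_herm : O1 \is hermsymmx.
Hypothesis O2_herm : O2 \is hermsymmx.
Hypothesis C_herm : C \is hermsymmx.
Hypothesis O1C : commutator O1 C = - (0 +i* 1) *: O2.
Hypothesis O2C : commutator O2 C = (0 +i* 1) *: O1.
Hypothesis O1O2 : commutator O1 O2 = (0 +i* gamma) *: C.

Lemma imaginaryE x : 0 +i* x = x%:C * (0 +i* 1) :> R[i].
Proof. by apply/eqP; rewrite eq_complex /= !mul0r mulr0 mulr1 subr0 addr0 !eqxx. Qed.

Lemma imaginary_sqr : (0 +i* 1) * (0 +i* 1) = -1 :> R[i].
Proof. exact: sqr_i. Qed.

Lemma ladder_signE b : (ladder_sign b)%:C * (ladder_sign b)%:C = 1.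
Proof. by rewrite -rmorphM; case: b; rewrite /= ?mulr1 ?mulrNN ?mulr1. Qed.

Lemma ladder_adj b : (ladder b)^t* = ladder (~~ b).
Proof.
rewrite /ladder trmxCD trmxCZ (hermsymmxE O1_herm) (hermsymmxE O2_herm); congr (_ + _ *: _).
by case: b; apply/eqP; rewrite eq_complex /= ?oppr0 ?opprK !eqxx.
Qed.

Lemma casimir_adj : casimir^t* = casimir.
Proof.
rewrite /casimir !trmxCD trmxCZ !trmxCM (hermsymmxE O1_herm) (hermsymmxE O2_herm).
by rewrite (hermsymmxE C_herm); congr (_ + _ *: _); apply: conjc_real.
Qed.

Lemma ladderC b : ladder b *m C = C *m ladder b - (ladder_sign b)%:C *: ladder b.
Proof.
have e1 : O1 *m C = C *m O1 - (0 +i* 1) *: O2.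
  by rewrite -scaleNr -O1C addrC subrK.
have e2 : O2 *m C = C *m O2 + (0 +i* 1) *: O1.
  by rewrite -O2C addrC subrK.
rewrite /ladder mulmxDl mulmxDr -scalemxAl -scalemxAr e1 e2 imaginaryE.
move: (C *m O1) (C *m O2) imaginary_sqr (ladder_signE b) => X Y.
move: (0 +i* 1) (ladder_sign b)%:C => I e hI he.
by mx_entries; ring: hI he.
Qed.

Lemma ladderM b : ladder (~~ b) *m ladder b =
  casimir - gamma%:C *: (C *m C) - (gamma * ladder_sign b)%:C *: C.
Proof.
have e : O1 *m O2 = O2 *m O1 + (0 +i* gamma) *: C by rewrite -O1O2 addrC subrK.
rewrite /ladder /casimir mulmxDl !mulmxDr -!scalemxAl -!scalemxAr e.
have -> : ladder_sign (~~ b) = - ladder_sign b by case: b; rewrite /= ?opprK.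
rewrite (imaginaryE (- ladder_sign b)) (imaginaryE (ladder_sign b)) (imaginaryE gamma).
rewrite rmorphM rmorphN /=.
move: (O1 *m O1) (O2 *m O1) (O2 *m O2) (C *m C) imaginary_sqr (ladder_signE b).
move: (0 +i* 1) (ladder_sign b)%:C gamma%:C => I e' g X Y Z T hI he.
by mx_entries; ring: hI he.
Qed.

Lemma ladderV b : ladder b *m ladder (~~ b) =
  casimir - gamma%:C *: (C *m C) + (gamma * ladder_sign b)%:C *: C.
Proof.
rewrite -{1}[b]negbK ladderM; case: b => /=; rewrite /ladder_sign;
  by rewrite ?(mulrN, mulr1) rmorphN scaleNr ?opprK.
Qed.

(** With [A] for [ladder b] and [A'] for its adjoint, the Casimir operator is [A A'] plus terms in
    [C], used on the left, and [A' A] plus terms in [C], used on the right. Both sides then contain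
    [A A' A], and the rest agrees once [C] is moved to the left. *)
Lemma casimir_ladder b : casimir *m ladder b = ladder b *m casimir.
Proof.
have e1 := ladderM b; have e2 := ladderV b.
set g := gamma%:C in e1 e2; set s := (ladder_sign b)%:C.
have gs : (gamma * ladder_sign b)%:C = g * s by rewrite -rmorphM.
have {1}-> : casimir = ladder b *m ladder (~~ b) + g *: (C *m C) - (g * s) *: C.
  by rewrite e2 gs; mx_entries; ring.
have -> : casimir = ladder (~~ b) *m ladder b + g *: (C *m C) + (g * s) *: C.
  by rewrite e1 gs; mx_entries; ring.
have AC := ladderC b; rewrite -/s in AC.
move: (ladder b) (ladder (~~ b)) AC => A B AC {e1 e2 gs}; clearbody g s.
have ACC : A *m (C *m C) = C *m (C *m A) - (s + s) *: (C *m A) + (s * s) *: A.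
  rewrite mulmxA AC mulmxBl -mulmxA AC mulmxBr -scalemxAl AC -scalemxAr.
  by move: (C *m (C *m A)) (C *m A) => X Y; mx_entries; ring.
rewrite mulmxDr mulmxDr -2!scalemxAr ACC AC mulmxBl mulmxDl -2!scalemxAl -2!mulmxA.
by move: (A *m (B *m A)) (C *m (C *m A)) (C *m A) => X Y Z; mx_entries; ring.
Qed.

Definition moment j (u : 'cV[R[i]]_n) : R := rdot u (iter j (mulmx casimir) u).

Lemma rdot_casimir_iter j u v :
  rdot u (iter j (mulmx casimir) v) = rdot (iter j (mulmx casimir) u) v.
Proof.
elim: j u v => // j IHj u v.
by rewrite iterS rdot_adj casimir_adj IHj -iterSr.
Qed.

Lemma rdot_herm (A : 'M[R[i]]_n) u : A \is hermsymmx -> rdot u (A *m A *m u) = rdot (A *m u) (A *m u).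
Proof. by move=> hA; rewrite -mulmxA rdot_adj hermsymmxE. Qed.

Hypothesis gamma_ge0 : 0 <= gamma.

(** Half of the factors move to the other side of the form; an odd one left over is a sum of squares
    with nonnegative coefficients. *)
Lemma moment_ge0 j u : 0 <= moment j u.
Proof.
suff [h0 h1] : (forall v, 0 <= moment (odd j) v) /\
    moment j u = moment (odd j) (iter j./2 (mulmx casimir) u).
  by rewrite h1.
split=> [v|]; last first.
  rewrite /moment -(rdot_casimir_iter j./2) -!iterD; congr (rdot _ (iter _ _ _)).
  by rewrite -[LHS]odd_double_half -addnn; lia.
case: (odd j); rewrite /moment /= ?rdot_ge0 //.
rewrite /casimir !mulmxDl -scalemxAl !rdotDr rdotZr !rdot_herm //.
by rewrite !addr_ge0 ?mulr_ge0 ?rdot_ge0.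
Qed.

Lemma iter_casimir_ladder j b (u : 'cV[R[i]]_n) :
  iter j (mulmx casimir) (ladder b *m u) = ladder b *m iter j (mulmx casimir) u.
Proof. by elim: j => // j IHj; rewrite !iterS IHj !mulmxA casimir_ladder. Qed.

(** The letter crosses to the left as its adjoint, and [ladderM] turns the pair into the Casimir
    operator up to terms that are scalar on [u]. This is the recursion for norms of words. *)
Lemma moment_ladder j b (m : R) (u : 'cV[R[i]]_n) : C *m u = m%:C *: u ->
  moment j (ladder b *m u) =
  moment j.+1 u - gamma * (m ^+ 2 + ladder_sign b * m) * moment j u.
Proof.
move=> Cu; rewrite /moment iter_casimir_ladder.
rewrite rdotC rdot_adj ladder_adj rdotC mulmxA ladderM iterS.
have Cr v : rdot u (C *m v) = m * rdot u v.
  by rewrite rdot_adj hermsymmxE // Cu rdotZl.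
rewrite !mulmxBl !rdotBr -!scalemxAl !rdotZr -mulmxA !Cr; ring.
Qed.

Variable Phi : 'cV[R[i]]_n.
Hypothesis CPhi : C *m Phi = 0.

Lemma C_act w : C *m act ladder w Phi = ((weight w)%:~R)%:C *: act ladder w Phi.
Proof.
elim: w => [|b w IHw]; first by rewrite /= CPhi /weight big_nil scale0r.
have e : C *m ladder b = ladder b *m C + (ladder_sign b)%:C *: ladder b.
  by rewrite ladderC subrK.
rewrite /= mulmxA e mulmxDl -mulmxA IHw weight_cons rmorphD rmorphD /=.
rewrite -scalemxAl -scalemxAr scalerDl addrC; congr (_ *: _ + _).
by case: b {e}; rewrite /= ?rmorphN1 ?rmorph1.
Qed.

Lemma moment_act_le j w : moment j (act ladder w Phi) <= moment (j + size w) Phi.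
Proof.
elim: w j => [|b w IHw] j /=; first by rewrite addn0.
rewrite (moment_ladder _ _ (C_act w)) addnS -addSn (le_trans _ (IHw _)) //.
rewrite gerBl mulr_ge0 ?moment_ge0 // mulr_ge0 //.
(* Integrality matters: [m ^+ 2 + m] and [m ^+ 2 - m] are nonnegative for integers, not for all
   reals. *)
set m := weight w; rewrite /ladder_sign.
have -> : (if b then 1 else -1 : R) = (if b then 1 else -1 : int)%:~R by case: b.
rewrite -rmorphXn -rmorphM -rmorphD /= ler0z.
by case: b; case: (ltgtP m 0); nia.
Qed.

(** * Growth of the moments under long-range order *)

Section Moments.
Variable s : R.
Hypothesis s_gt0 : 0 < s.
Hypothesis Phi1 : rdot Phi Phi = 1.
Hypothesis moment1 : s ^+ 2 <= moment 1 Phi.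

(* Log-convexity of the moments of the spectral measure of the Casimir
   operator in [Phi]. *)
Lemma moment_ratio j : 0 < moment j Phi /\ s ^+ 2 * moment j Phi <= moment j.+1 Phi.
Proof.
elim: j => [|j [p le]]; first by rewrite {1 2}/moment /= Phi1 mulr1.
have p1 : 0 < moment j.+1 Phi by apply: lt_le_trans le; rewrite mulr_gt0 ?exprn_gt0.
split; first exact: p1.
set t := moment j.+1 Phi / moment j Phi.
have tE : t * moment j Phi = moment j.+1 Phi by rewrite divfK // gt_eqF.
have ts : s ^+ 2 <= t by rewrite ler_pdivlMr.
(* As [t] is the ratio of two consecutive moments, expanding this gives
   [t ^+ 2 * moment j Phi <= moment j.+2 Phi]. *)
have := moment_ge0 j (casimir *m Phi - t%:C *: Phi).
have iterB v1 v2 : iter j (mulmx casimir) (v1 - v2) =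
    iter j (mulmx casimir) v1 - iter j (mulmx casimir) v2.
  by elim: j {p le p1 t tE ts} => // j IHj; rewrite !iterS IHj mulmxBr.
have iterZ (a : R[i]) v : iter j (mulmx casimir) (a *: v) = a *: iter j (mulmx casimir) v.
  by elim: j {p le p1 t tE ts iterB} => // j IHj; rewrite !iterS IHj scalemxAr.
rewrite /moment iterB iterZ -iterSr rdotBr !rdotBl !rdotZr !rdotZl.
have e i : rdot (casimir *m Phi) (iter i (mulmx casimir) Phi) = moment i.+1 Phi.
  by rewrite /moment iterS [RHS]rdot_adj casimir_adj.
rewrite !e -/(moment j Phi) -/(moment j.+1 Phi) -tE => h.
have : t * (t * moment j Phi) <= moment j.+2 Phi by lra.
by apply: le_trans; rewrite ler_wpM2r // tE ltW.
Qed.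

(** Adding a letter to [k] equal ones loses [gamma * (k ^+ 2 + k)] times a moment that
    [moment_ratio] bounds by the next one over [s ^+ 2]. The cube is a crude bound on the
    accumulated loss. *)
Lemma moment_nseq_ge j b k :
  (s ^+ 2 - gamma * k%:R ^+ 3) * moment (j + k) Phi <=
  s ^+ 2 * moment j (act ladder (nseq k b) Phi).
Proof.
elim: k j => [|k IHk] j; first by rewrite expr0n mulr0 subr0 addn0.
rewrite /= (moment_ladder _ _ (C_act _)) weight_nseq mulrBr.
have -> : ((if b then k%:Z else - k%:Z)%:~R : R) = ladder_sign b * k%:R.
  by rewrite /ladder_sign; case: b {IHk}; rewrite ?mul1r ?mulN1r ?rmorphN.
have -> : (ladder_sign b * k%:R) ^+ 2 + ladder_sign b * (ladder_sign b * k%:R) =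
    k%:R ^+ 2 + k%:R.
  by rewrite /ladder_sign; case: b {IHk}; ring.
have := IHk j.+1; rewrite addSn addnS => h.
have le : s ^+ 2 * moment j (act ladder (nseq k b) Phi) <= moment (j + k).+1 Phi.
  apply: le_trans (moment_ratio (j + k)).2; rewrite ler_wpM2l ?sqr_ge0 //.
  by have := moment_act_le j (nseq k b); rewrite size_nseq.
have c0 : 0 <= gamma * (k%:R ^+ 2 + k%:R).
  by rewrite mulr_ge0 // addr_ge0 ?exprn_ge0.
have := ler_wpM2l c0 le; have p := (moment_ratio (j + k).+1).1.
have k3 : (k.+1%:R : R) ^+ 3 = k%:R ^+ 3 + 3 * k%:R ^+ 2 + 3 * k%:R + 1.
  by rewrite -natr1; ring.
(* The slack: the increment of the cube minus [k ^+ 2 + k]. *)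
have : 0 <= gamma * (2 * k%:R ^+ 2 + 2 * k%:R + 1) * moment (j + k).+1 Phi.
  by rewrite !mulr_ge0 ?addr_ge0 ?mulr_ge0 ?exprn_ge0 // ltW.
rewrite k3; move: h; set X := moment _ _; set Y := moment _ _; set Z := moment _ _.
lra.
Qed.

End Moments.
End Ladder.

(** * Matrix elements of local operators between words in the ladder operators *)

Section Rearrange.
Variables (R : realType) (f : seq bool -> R) (e : R) (n : nat) (b : bool).
Hypothesis swap : forall u1 c u2, (size u1 + size u2).+2 = n ->
  `|f (u1 ++ c :: ~~ c :: u2) - f (u1 ++ ~~ c :: c :: u2)| <= e.

Lemma move_letter m u1 u2 : (size u1 + m + size u2).+1 = n ->
  `|f (u1 ++ b :: nseq m (~~ b) ++ u2) - f (u1 ++ nseq m (~~ b) ++ b :: u2)|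
    <= m%:R * e.
Proof.
elim: m u1 => [|m IHm] u1 hn; first by rewrite subrr normr0 mul0r.
have h1 := @swap u1 b (nseq m (~~ b) ++ u2).
have h2 := IHm (rcons u1 (~~ b)).
rewrite !cat_rcons in h2; rewrite -natr1 mulrDl mul1r [leRHS]addrC.
apply: le_trans (ler_distD (f (u1 ++ ~~ b :: b :: nseq m (~~ b) ++ u2)) _ _) _.
apply: lerD; [apply: h1 | apply: h2].
  by rewrite size_cat size_nseq -hn; lia.
by rewrite size_rcons -hn; lia.
Qed.

(** The last letter of the first block crosses the second block first and then joins the tail, so
    [move_letter] is applied [k] times. *)
Lemma move_block k m u : (k + m + size u)%N = n ->
  `|f (nseq k b ++ nseq m (~~ b) ++ u) - f (nseq m (~~ b) ++ nseq k b ++ u)|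
    <= (k * m)%:R * e.
Proof.
elim: k u => [|k IHk] u hn; first by rewrite subrr normr0 mul0r.
have nseqE x : nseq k.+1 b ++ x = nseq k b ++ b :: x.
  by rewrite -cat_rcons -[in LHS]addn1 nseqD cats1.
rewrite !nseqE mulSn natrD mulrDl.
apply: le_trans (ler_distD (f (nseq k b ++ nseq m (~~ b) ++ b :: u)) _ _) _.
apply: lerD; first by apply: move_letter; rewrite size_nseq -hn; lia.
by apply: IHk; rewrite /= -hn; lia.
Qed.

End Rearrange.

Section Estimates.
Local Open Scope sesquilinear_scope.
Variables (R : realType) (n : nat) (A : bool -> 'M[R[i]]_n) (C : 'M[R[i]]_n).
Variables (Phi : 'cV[R[i]]_n) (gamma s kappa : R) (t : nat -> R).
(** An abstract notion of locality with norm bound, stable under commutators with the ladder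
    operators at cost [kappa], so that commutators can be nested. *)
Variable local : R -> 'M[R[i]]_n -> Prop.
Implicit Types (u w : seq bool) (g : 'M[R[i]]_n) (c : R).

Hypothesis gamma_ge0 : 0 <= gamma.
Hypothesis s_gt0 : 0 < s.
Hypothesis kappa_ge0 : 0 <= kappa.
Hypothesis A_adj : forall b, (A b)^t* = A (~~ b).
Hypothesis A_swap : forall b,
  commutator (A b) (A (~~ b)) = (2 * gamma * ladder_sign R b)%:C *: C.
Hypothesis C_act : forall w, C *m act A w Phi = ((weight w)%:~R)%:C *: act A w Phi.
Hypothesis t_ge0 : forall j, 0 <= t j.
Hypothesis t_step : forall j, s * t j <= t j.+1.
Hypothesis hnorm_act : forall w, hnorm (act A w Phi) <= t (size w).
Hypothesis local_ge0 : forall c g, local c g -> 0 <= c.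
Hypothesis local_bounded : forall c g, local c g -> bounded_by g c.
Hypothesis local_commutator : forall c g b,
  local c g -> local (kappa * c) (commutator (A b) g).

(** The Cauchy-Schwarz bound for [j] letters shared as evenly as possible between the two sides of a
    matrix element. *)
Definition balanced j : R := t (uphalf j) * t j./2.

Lemma balanced_ge0 j : 0 <= balanced j.
Proof. by rewrite mulr_ge0. Qed.

Lemma balanced_step j : balanced j <= balanced j.+1 / s.
Proof.
rewrite ler_pdivlMr // /balanced /= mulrC [leRHS]mulrC mulrCA.
by rewrite ler_wpM2l.
Qed.

Definition corr g u w := rdot (act A u Phi) (g *m act A w Phi).

(** A letter changes sides as its adjoint; passing [g] leaves a commutator with one letter fewer. *)
Lemma corr_move g b u w :
  corr g (b :: u) w = corr g u (~~ b :: w) + corr (commutator (A (~~ b)) g) u w.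
Proof.
rewrite /corr -rdotDr /= mulmxBl !mulmxA addrC subrK -mulmxA.
by rewrite [RHS]rdot_adj A_adj negbK.
Qed.

(* Letters are moved across [g] until both words have the same length up to one;
   a letter that is absorbed in a commutator costs [kappa] and saves a factor [s]. *)
Lemma local_estimate d c g u w : local c g ->
  (size u <= size w + d.+1)%N -> (size w <= size u + d.+1)%N ->
  `|corr g u w| <= c * (1 + kappa / s) ^+ d * balanced (size u + size w).
Proof.
have x0 : 0 <= kappa / s by rewrite divr_ge0 // ltW.
elim: d c g u w => [|d IHd] c g u w lg.
  move=> hu hw; have c0 := local_ge0 lg; rewrite expr0 mulr1.
  apply: le_trans (normr_rdot _ _) _.
  (* Here the two lengths differ by at most one, so the split is already the balanced one. *)
  have -> : balanced (size u + size w) = t (size u) * t (size w).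
    have [->|[->|->]] : size u = size w \/ size u = (size w).+1 \/ size w = (size u).+1 by lia.
    - by rewrite /balanced addnn uphalf_double doubleK.
    - by rewrite /balanced addSn addnn /= uphalf_double doubleK.
    - by rewrite /balanced addnS addnn /= uphalf_double doubleK mulrC.
  rewrite mulrCA; apply: ler_pM; rewrite ?hnorm_ge0 //.
  by apply: le_trans (local_bounded lg _) _; rewrite ler_wpM2l.
have mono x y : local x y -> (size u <= size w + d.+1)%N ->
    (size w <= size u + d.+1)%N ->
    `|corr y u w| <= x * (1 + kappa / s) ^+ d.+1 * balanced (size u + size w).
  move=> lxy h1 h2; apply: le_trans (IHd _ _ _ _ lxy h1 h2) _.
  rewrite ler_wpM2r ?balanced_ge0 // ler_wpM2l ?(local_ge0 lxy) //.
  by rewrite exprS ler_peMl ?exprn_ge0 ?addr_ge0 // lerDl.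
(* One move: [x] keeps all the letters, [z] has lost one to a commutator. Since [balanced_step]
   regains that letter at cost [1 / s], the two add up to the factor [1 + kappa / s]. *)
have step (x : R) j : 0 <= c ->
    `|x| <= c * (1 + kappa / s) ^+ d * balanced j.+1 ->
    forall z, `|z| <= kappa * c * (1 + kappa / s) ^+ d * balanced j ->
    `|x + z| <= c * (1 + kappa / s) ^+ d.+1 * balanced j.+1.
  move=> c0 hx z hz; apply: le_trans (ler_normD _ _) _.
  apply: le_trans (lerD hx hz) _.
  rewrite exprSr mulrA mulrDr mulr1 mulrDl lerD2l.
  have -> : c * (1 + kappa / s) ^+ d * (kappa / s) * balanced j.+1 =
    kappa * c * (1 + kappa / s) ^+ d * (balanced j.+1 / s) by ring.
  by rewrite ler_wpM2l ?balanced_step // !mulr_ge0 ?exprn_ge0 ?addr_ge0.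
move=> hu hw; have c0 := local_ge0 lg.
have [h1|h1] := leqP (size u) (size w + d.+1); last first.
  case: u {mono} hu hw h1 => [|b u]; first by rewrite /= ltn0.
  rewrite /= => hu hw h1; rewrite corr_move addSn.
  apply: (step _ _ c0).
    rewrite -addnS -[(size w).+1]/(size (~~ b :: w)).
    by apply: IHd; [exact: lg | rewrite /=; lia | rewrite /=; lia].
  by apply: IHd; [exact: local_commutator | lia | lia].
have [h2|h2] := leqP (size w) (size u + d.+1); first exact: mono.
case: w {mono} hu hw h1 h2 => [|b w]; first by rewrite /= ltn0.
rewrite /= => hu hw h1 h2; rewrite addnS.
have -> : corr g u (b :: w) =
    corr g (~~ b :: u) w + - corr (commutator (A b) g) u w.
  by rewrite corr_move negbK addrK.
apply: (step _ _ c0).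
  rewrite -addSn -[(size u).+1]/(size (~~ b :: u)).
  by apply: IHd; [exact: lg | rewrite /=; lia | rewrite /=; lia].
by rewrite normrN; apply: IHd; [exact: local_commutator | lia | lia].
Qed.

Variable M : nat.
Hypothesis small : (1 + kappa / s) ^+ M.*2 <= 2.

(** With at most [2 * M] letters the imbalance is at most [2 * M], so the exponent in [small]
    suffices. *)
Lemma local_estimate_small c g u w : local c g -> (size u + size w <= M.*2)%N ->
  `|corr g u w| <= 2 * c * balanced (size u + size w).
Proof.
move=> lg h; apply: le_trans (@local_estimate M.*2 c g u w lg _ _) _; try lia.
by rewrite mulrC [leRHS]mulrC ler_wpM2l ?balanced_ge0 // [leRHS]mulrC ler_wpM2l // (local_ge0 lg).
Qed.

Lemma act_swap u1 b u2 :
  act A (u1 ++ b :: ~~ b :: u2) Phi - act A (u1 ++ ~~ b :: b :: u2) Phi =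
  (2 * gamma * ladder_sign R b * (weight u2)%:~R)%:C *: act A (u1 ++ u2) Phi.
Proof.
rewrite !act_cat /= -actB !mulmxA -mulmxBl -/(act A) -/(commutator _ _) A_swap.
by rewrite -scalemxAl C_act scalerA -rmorphM actZ.
Qed.

Lemma swap_coef b u : (size u <= M.*2)%N ->
  `|2 * gamma * ladder_sign R b * (weight u)%:~R| <= 4 * gamma * M%:R.
Proof.
move=> h; rewrite !normrM.
have -> : `|ladder_sign R b| = 1 by case: b; rewrite /= ?normrN normr1.
rewrite mulr1 (ger0_norm gamma_ge0) normr_nat.
have : `|(weight u)%:~R : R| <= (M.*2)%:R.
  rewrite -intr_norm (_ : M.*2%:R = (M.*2)%:Z%:~R) // ler_int.
  by apply: le_trans (normr_weight _) _; rewrite lez_nat.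
rewrite -muln2 natrM => hw.
have -> : 4 * gamma * M%:R = 2 * gamma * (M%:R * 2) by ring.
by rewrite ler_wpM2l // mulr_ge0.
Qed.

(** A transposition leaves a charge, bounded by [swap_coef], and deletes two letters, each worth
    [1 / s] by [balanced_step]. *)
Lemma swap_bound c g x y j b u : local c g -> (size u <= M.*2)%N ->
  (size x + size y = j)%N -> (j.+2 <= M.*2)%N ->
  `|2 * gamma * ladder_sign R b * (weight u)%:~R * corr g x y| <=
  8 * gamma * M%:R * c * balanced j.+2 / s ^+ 2.
Proof.
move=> lg hu hj h; rewrite normrM; have c0 := local_ge0 lg.
have hc : `|corr g x y| <= 2 * c * (balanced j.+2 / s ^+ 2).
  apply: le_trans (local_estimate_small lg _) _; first by rewrite hj; lia.
  rewrite hj ler_wpM2l ?mulr_ge0 // (le_trans (balanced_step _)) //.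
  by rewrite expr2 invfM mulrA ler_pM2r ?invr_gt0 // balanced_step.
apply: le_trans (ler_pM _ _ (swap_coef b hu) hc) _ => //.
by rewrite le_eqVlt; apply/orP; left; apply/eqP; ring.
Qed.

Lemma corr_swap_left c g w u1 b u2 : local c g ->
  ((size u1 + size u2).+2 + size w <= M.*2)%N ->
  `|corr g (u1 ++ b :: ~~ b :: u2) w - corr g (u1 ++ ~~ b :: b :: u2) w| <=
  8 * gamma * M%:R * c * balanced ((size u1 + size u2).+2 + size w) / s ^+ 2.
Proof.
move=> lg h; rewrite /corr -rdotBl act_swap rdotZl -/(corr g (u1 ++ u2) w) !addSn.
by apply: (swap_bound _ lg); rewrite ?size_cat //; lia.
Qed.

Lemma corr_swap_right c g u w1 b w2 : local c g ->
  (size u + (size w1 + size w2).+2 <= M.*2)%N ->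
  `|corr g u (w1 ++ b :: ~~ b :: w2) - corr g u (w1 ++ ~~ b :: b :: w2)| <=
  8 * gamma * M%:R * c * balanced (size u + (size w1 + size w2).+2) / s ^+ 2.
Proof.
move=> lg h; rewrite /corr -rdotBr -mulmxBr act_swap -scalemxAr rdotZr.
rewrite -/(corr g u (w1 ++ w2)) !addnS.
by apply: (swap_bound _ lg); rewrite ?size_cat //; lia.
Qed.

(** Each of the [j] moves across [g] leaves a commutator with cost [kappa] and one letter fewer,
    hence the factor [kappa / s]. *)
Lemma corr_move_block c g b j u w : local c g ->
  (j + size u + size w <= M.*2)%N ->
  `|corr g (nseq j b ++ u) w - corr g u (nseq j (~~ b) ++ w)| <=
  j%:R * (2 * kappa * c * balanced (j + size u + size w) / s).
Proof.
move=> lg; elim: j w => [|j IHj] w h; first by rewrite subrr normr0 mul0r.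
have -> : nseq j.+1 (~~ b) ++ w = nseq j (~~ b) ++ ~~ b :: w.
  by rewrite -cat_rcons -addn1 nseqD cats1.
have := IHj (~~ b :: w); rewrite /= !addSn !addnS => /(_ ltac:(lia)) h1.
rewrite corr_move addrAC -natr1 mulrDl mul1r.
apply: le_trans (ler_normD _ _) (lerD h1 _).
apply: le_trans (local_estimate_small (local_commutator _ lg) _) _.
  by rewrite size_cat size_nseq; lia.
have c0 := local_ge0 lg.
rewrite size_cat size_nseq mulrA -[leRHS]mulrA ler_wpM2l ?mulr_ge0 //.
exact: balanced_step.
Qed.

(** Three stages: the block of [M] letters [b] is brought to the front of the left word, carried
    across [g] as letters [~~ b], and then pushed behind the [l] letters of the right word. The
    transpositions number [(k + l) * M], at most [M ^ 2]. *)
Lemma corr_cycle c g b k l : local c g -> (k + l).+1 = M ->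
  `|corr g (nseq k (~~ b) ++ nseq M b) (nseq l b) -
    corr g (nseq k (~~ b)) (nseq l b ++ nseq M (~~ b))| <=
  (8 * gamma * M%:R ^+ 3 / s ^+ 3 + 2 * kappa * M%:R / s ^+ 2) * c * t M ^+ 2.
Proof.
move=> lg hM; have c0 := local_ge0 lg.
set nb := (M + k + l)%N; pose B := balanced nb.
(* The words have [2 * M - 1] letters, one short of the [2 * M] for which [balanced] is [t M ^+ 2];
   the missing letter gives [1 / s]. *)
have hB : B <= t M ^+ 2 / s.
  have -> : t M ^+ 2 = balanced nb.+1.
    rewrite /balanced (_ : nb.+1 = M.*2); last by rewrite /nb -addnn -hM; lia.
    by rewrite uphalf_double doubleK expr2.
  exact: balanced_step.
pose e := 8 * gamma * M%:R * c * B / s ^+ 2.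
have h1 := @move_block R (fun u => corr g u (nseq l b)) e (k + M) (~~ b) _ k M [::].
have h2 := @move_block R (fun w => corr g (nseq k (~~ b)) w) e (l + M) b _ l M [::].
have h3 := @corr_move_block c g b M (nseq k (~~ b)) (nseq l b) lg.
rewrite !cats0 negbK in h1; rewrite !cats0 in h2; rewrite !size_nseq in h3.
have {}h1 : `|corr g (nseq k (~~ b) ++ nseq M b) (nseq l b) -
    corr g (nseq M b ++ nseq k (~~ b)) (nseq l b)| <= (k * M)%:R * e.
  apply: h1; rewrite ?addn0 // => u1 a u2 hs.
  have := @corr_swap_left c g (nseq l b) u1 a u2 lg; rewrite size_nseq hs.
  rewrite (_ : k + M + l = nb)%N; last by rewrite /nb; lia.
  by apply; rewrite /nb -addnn; lia.
have {}h2 : `|corr g (nseq k (~~ b)) (nseq l b ++ nseq M (~~ b)) -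
    corr g (nseq k (~~ b)) (nseq M (~~ b) ++ nseq l b)| <= (l * M)%:R * e.
  apply: h2; rewrite ?addn0 // => u1 a u2 hs.
  have := @corr_swap_right c g (nseq k (~~ b)) u1 a u2 lg; rewrite size_nseq hs.
  rewrite (_ : k + (l + M) = nb)%N; last by rewrite /nb; lia.
  by apply; rewrite /nb -addnn; lia.
have {}h3 := h3 ltac:(rewrite -addnn; lia); rewrite -/nb -/B in h3.
apply: le_trans (ler_distD (corr g (nseq M b ++ nseq k (~~ b)) (nseq l b)) _ _) _.
apply: le_trans (lerD h1 (ler_distD (corr g (nseq k (~~ b)) (nseq M (~~ b) ++ nseq l b)) _ _)) _.
rewrite distrC in h2; apply: le_trans (lerD (lexx _) (lerD h3 h2)) _.
have kl : (k * M)%:R + (l * M)%:R <= M%:R ^+ 2 :> R.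
  by rewrite -natrD -natrX ler_nat; nia.
have e0 : 0 <= e.
  by rewrite /e !mulr_ge0 ?balanced_ge0 ?invr_ge0 ?exprn_ge0 // ltW.
have -> : (k * M)%:R * e + (M%:R * (2 * kappa * c * B / s) + (l * M)%:R * e) =
    ((k * M)%:R + (l * M)%:R) * e + 2 * kappa * M%:R / s * c * B by ring.
apply: le_trans (lerD (ler_wpM2r e0 kl) (lexx _)) _.
have -> : M%:R ^+ 2 * e + 2 * kappa * M%:R / s * c * B =
    (8 * gamma * M%:R ^+ 3 / s ^+ 2 + 2 * kappa * M%:R / s) * c * B.
  by rewrite /e; ring.
have -> : (8 * gamma * M%:R ^+ 3 / s ^+ 3 + 2 * kappa * M%:R / s ^+ 2) * c * t M ^+ 2 =
   (8 * gamma * M%:R ^+ 3 / s ^+ 2 + 2 * kappa * M%:R / s) * c * (t M ^+ 2 / s).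
  by field; rewrite gt_eqF.
by rewrite ler_wpM2l // mulr_ge0 // addr_ge0 // !mulr_ge0 ?invr_ge0 ?exprn_ge0 // ltW.
Qed.

End Estimates.

(** * Local commutators and the energy excess *)

Section Commutators.
Variables (R : realType) (n : nat).
Implicit Types (A B G : 'M[R[i]]_n).

Lemma commutatorC A B : commutator B A = - commutator A B.
Proof. by rewrite /commutator opprB. Qed.

Lemma commutator_eq0 A B : commutator A B = 0 -> A *m B = B *m A.
Proof. by move/eqP; rewrite subr_eq0 => /eqP. Qed.

Lemma commute_commutator A B G :
  A *m G = G *m A -> B *m G = G *m B -> commutator (commutator A B) G = 0.
Proof.
move=> AG BG; rewrite {1}/commutator /commutator mulmxBl mulmxBr -!mulmxA.
by rewrite AG BG (mulmxA A G) (mulmxA B G) AG BG -!mulmxA subrr.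
Qed.

Lemma commutator_suml (I : Type) (r : seq I) (P : pred I) (F : I -> 'M[R[i]]_n) B :
  commutator (\sum_(x <- r | P x) F x) B = \sum_(x <- r | P x) commutator (F x) B.
Proof. by rewrite /commutator mulmx_suml mulmx_sumr -sumrB. Qed.

Lemma commutator_adj A B :
  ((commutator A B)^t* = commutator (B^t* ) (A^t* ))%sesqui.
Proof.
by rewrite /commutator linearB map_mxB /= !trmxCM.
Qed.

End Commutators.

(** * Operators localized near a bounded set of sites *)

Section LocalOperators.
Variables (R : realType) (n : nat) (Lam : finType) (A : bool -> Lam -> 'M[R[i]]_n).
Variables (S : {set Lam}) (r : nat) (a : R).
Implicit Types (c : R) (g : 'M[R[i]]_n).

Hypothesis card_S : (#|S| <= r)%N.
Hypothesis a_ge0 : 0 <= a.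
Hypothesis A_bounded : forall b x, bounded_by (A b x) a.
Hypothesis A_comm : forall b b' x y, x != y -> commutator (A b x) (A b' y) = 0.

(** Support in [S] is expressed only through commutation with the one-site ladder operators outside
    [S]. *)
Definition local_at c g := [/\ 0 <= c, bounded_by g c &
  forall b y, y \notin S -> commutator g (A b y) = 0].

Lemma local_atN c g : local_at c g -> local_at c (- g).
Proof.
move=> [c0 hg hl]; split; [exact: c0 | exact: bounded_byN |].
by move=> b y /(hl b) /commutator_eq0 e; rewrite /commutator mulNmx mulmxN e subrr.
Qed.

(** Only the sites of [S] contribute, at most [r] of them. The support does not grow, because ladder
    operators at distinct sites commute, so the same factor serves for every nested commutator. *)
Lemma local_at_commutator c g b : local_at c g ->
  local_at (r%:R * (2 * a) * c) (commutator (\sum_x A b x) g).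
Proof.
move=> [c0 hg hl].
have -> : commutator (\sum_x A b x) g = \sum_(x in S) commutator (A b x) g.
  rewrite commutator_suml (bigID (mem S)) /= [X in _ + X]big1 ?addr0 // => x xS.
  by rewrite commutatorC hl ?oppr0.
split.
- by rewrite !mulr_ge0.
- have hS : bounded_by (\sum_(x in S) commutator (A b x) g) (\sum_(x in S) 2 * a * c).
    by apply: bounded_by_sum => x _; apply: bounded_by_commutator.
  move=> v; apply: le_trans (hS v) _; rewrite ler_wpM2r ?hnorm_ge0 //.
  have -> : r%:R * (2 * a) * c = r%:R * (2 * a * c) by rewrite !mulrA.
  by rewrite sumr_const -[X in X <= _]mulr_natl ler_wpM2r ?ler_nat // !mulr_ge0.
- move=> b' y yS; rewrite commutator_suml big1 // => x xS.
  apply: commute_commutator; apply: commutator_eq0; last exact: hl.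
  by apply: A_comm; apply: contraNneq yS => <-.
Qed.

End LocalOperators.

(** * Telescoping the energy excess over the letters *)

Section Excess.
Local Open Scope sesquilinear_scope.
Variables (R : realType) (n : nat) (A : bool -> 'M[R[i]]_n).
Variables (H : 'M[R[i]]_n) (Phi : 'cV[R[i]]_n).

Hypothesis A_adj : forall b, (A b)^t* = A (~~ b).
Hypothesis H_adj : H^t* = H.
Hypothesis HPhi : H *m Phi = 0.

(** [H] is pushed through the word until it annihilates [Phi], leaving one commutator per letter. *)
Lemma mul_act_nseq b M : H *m act A (nseq M b) Phi =
  \sum_(k < M) act A (nseq k b)
    (commutator H (A b) *m act A (nseq (M - k.+1) b) Phi).
Proof.
elim: M => [|M IHM]; first by rewrite big_ord0 /= HPhi.
rewrite big_ord_recl /= subSS subn0.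
have -> : H *m (A b *m act A (nseq M b) Phi) =
    commutator H (A b) *m act A (nseq M b) Phi + A b *m (H *m act A (nseq M b) Phi).
  by rewrite mulmxBl !mulmxA subrK.
by rewrite IHM mulmx_sumr; congr (_ + _).
Qed.

Lemma rdot_act_nseq b k u v :
  rdot u (act A (nseq k b) v) = rdot (act A (nseq k (~~ b)) u) v.
Proof.
elim: k u => //= k IHk u; rewrite rdot_adj A_adj IHk; congr (rdot _ v).
by elim: k {IHk} => //= k ->.
Qed.

Definition excess b M : R :=
  rdot (act A (nseq M b) Phi) (H *m act A (nseq M b) Phi).

Lemma excessE b M : excess b M =
  \sum_(k < M) corr A Phi (commutator H (A b))
    (nseq k (~~ b) ++ nseq M b) (nseq (M - k.+1) b).
Proof.
rewrite /excess mul_act_nseq rdot_sumr; apply: eq_bigr => k _.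
by rewrite rdot_act_nseq /corr act_cat.
Qed.

(** Taking adjoints exchanges the two words and turns [commutator H (A (~~ b))] into minus
    [commutator H (A b)]; reversing the summation index then aligns the terms with those of
    [excessE]. *)
Lemma excess_negbE b M : excess (~~ b) M =
  - \sum_(k < M) corr A Phi (commutator H (A b))
      (nseq k (~~ b)) (nseq (M - k.+1) b ++ nseq M (~~ b)).
Proof.
rewrite excessE negbK (reindex_inj rev_ord_inj) /= -sumrN.
apply: eq_bigr => k _.
have -> : (M - (M - k.+1).+1)%N = k by have := ltn_ord k; lia.
rewrite /corr rdot_adj commutator_adj H_adj A_adj negbK commutatorC mulNmx.
by rewrite rdotC rdotNr.
Qed.

Lemma excess_sum b M : excess b M + excess (~~ b) M =
  \sum_(k < M) (corr A Phi (commutator H (A b))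
      (nseq k (~~ b) ++ nseq M b) (nseq (M - k.+1) b) -
    corr A Phi (commutator H (A b))
      (nseq k (~~ b)) (nseq (M - k.+1) b ++ nseq M (~~ b))).
Proof. by rewrite excessE excess_negbE sumrB. Qed.

End Excess.

(** * The trial states *)

Section TrialStates.
Local Open Scope sesquilinear_scope.
Variables (R : realType) (n : nat) (Lam : finType).
Variables (hloc : Lam -> 'M[R[i]]_n) (oloc : 'I_2 -> Lam -> 'M[R[i]]_n).
Variables (C : 'M[R[i]]_n) (E0 : R) (Phi : 'cV[R[i]]_n).
Variables (h o gamma s : R) (r M : nat) (S : Lam -> {set Lam}).

Let H : 'M[R[i]]_n := \sum_x hloc x.
Let O1 : 'M[R[i]]_n := \sum_x oloc 0 x.
Let O2 : 'M[R[i]]_n := \sum_x oloc 1 x.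
(** At most [r] sites, a factor 2 from each commutator, and [2 * o] as bound on a one-site ladder
    operator. *)
Let kappa : R := r%:R * (2 * (2 * o)).
Let t j : R := Num.sqrt (moment O1 O2 C gamma j Phi).

Hypothesis h_ge0 : 0 <= h.
Hypothesis o_ge0 : 0 <= o.
Hypothesis gamma_ge0 : 0 <= gamma.
Hypothesis s_gt0 : 0 < s.
Hypothesis H_herm : H \is hermsymmx.
Hypothesis O1_herm : O1 \is hermsymmx.
Hypothesis O2_herm : O2 \is hermsymmx.
Hypothesis C_herm : C \is hermsymmx.
Hypothesis O1C : commutator O1 C = - (0 +i* 1) *: O2.
Hypothesis O2C : commutator O2 C = (0 +i* 1) *: O1.
Hypothesis O1O2 : commutator O1 O2 = (0 +i* gamma) *: C.
Hypothesis E0_ground : ground_energy H E0.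
Hypothesis HPhi : H *m Phi = E0%:C *: Phi.
Hypothesis Phi1 : rdot Phi Phi = 1.
Hypothesis CPhi : C *m Phi = 0.
Hypothesis o_comm : forall a b x y, x != y -> commutator (oloc a x) (oloc b y) = 0.
Hypothesis card_S : forall x, (#|S x| <= r)%N.
Hypothesis h_local : forall x a y, y \notin S x -> commutator (hloc x) (oloc a y) = 0.
Hypothesis h_bounded : forall x, bounded_by (hloc x) h.
Hypothesis o_bounded : forall a x, bounded_by (oloc a x) o.
Hypothesis order : s ^+ 2 <= rdot Phi (O1 *m O1 *m Phi).
Hypothesis small : (1 + kappa / s) ^+ M.*2 <= 2.
Hypothesis small3 : 2 * (gamma * M%:R ^+ 3) <= s ^+ 2.

Let A := ladder O1 O2.

Let lad b x := oloc 0 x + (0 +i* ladder_sign R b) *: oloc 1 x.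

Let ladE b : A b = \sum_x lad b x.
Proof. by rewrite /A /ladder scaler_sumr -big_split. Qed.

Let lad_bounded b x : bounded_by (lad b x) (2 * o).
Proof.
rewrite mulr_natl mulr2n; apply: bounded_byD => //.
have := bounded_byZ (0 +i* ladder_sign R b) (o_bounded 1 x).
rewrite normc_def /= expr0n add0r.
have -> : ladder_sign R b ^+ 2 = 1 by case: b; rewrite /= ?sqrrN expr1n.
by rewrite sqrtr1 mul1r.
Qed.

Let commutator_lad (G : 'M[R[i]]_n) b x :
  (forall a, commutator G (oloc a x) = 0) -> commutator G (lad b x) = 0.
Proof.
move=> hG; rewrite /lad /commutator mulmxDr mulmxDl -scalemxAr -scalemxAl.
by rewrite !(commutator_eq0 (hG _)) subrr.
Qed.

Let lad_comm b b' x y : x != y -> commutator (lad b x) (lad b' y) = 0.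
Proof.
move=> xy; apply: commutator_lad => a; rewrite commutatorC commutator_lad ?oppr0 //.
by move=> a'; apply: o_comm; rewrite eq_sym.
Qed.

Let A_adj b : (A b)^t* = A (~~ b).
Proof. exact: ladder_adj. Qed.

Let A_swap b : commutator (A b) (A (~~ b)) = (2 * gamma * ladder_sign R b)%:C *: C.
Proof.
rewrite /commutator (ladderV O1O2) (ladderM O1O2) opprB addrC addrA subrK.
rewrite -scalerDl -rmorphD; congr (_%:C *: _); ring.
Qed.

Let t_ge0 j : 0 <= t j.
Proof. exact: sqrtr_ge0. Qed.

Let moment1 : s ^+ 2 <= moment O1 O2 C gamma 1 Phi.
Proof.
rewrite /moment /= /casimir !mulmxDl -scalemxAl !rdotDr rdotZr -addrA.
apply: le_trans order _; rewrite lerDl.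
rewrite (rdot_herm _ O2_herm) (rdot_herm _ C_herm).
by rewrite addr_ge0 ?mulr_ge0 ?rdot_ge0.
Qed.

Let ratio := moment_ratio O1_herm O2_herm C_herm gamma_ge0 s_gt0 Phi1 moment1.

Let t_step j : s * t j <= t j.+1.
Proof.
rewrite /t -[in s * _](ger0_norm (ltW s_gt0)) -sqrtr_sqr -sqrtrM ?sqr_ge0 //.
by apply: ler_wsqrtr; have [] := ratio j.
Qed.

Let hnorm_act w : hnorm (act A w Phi) <= t (size w).
Proof.
apply: ler_wsqrtr.
exact: (moment_act_le O1_herm O2_herm C_herm O1C O2C O1O2 gamma_ge0 CPhi 0).
Qed.

Let local x := local_at lad (S x).

Let cycle x c g b k l : local x c g -> (k + l).+1 = M ->
  `|corr A Phi g (nseq k (~~ b) ++ nseq M b) (nseq l b) -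
    corr A Phi g (nseq k (~~ b)) (nseq l b ++ nseq M (~~ b))| <=
  (8 * gamma * M%:R ^+ 3 / s ^+ 3 + 2 * kappa * M%:R / s ^+ 2) * c * t M ^+ 2.
Proof.
have k0 : 0 <= kappa by rewrite !mulr_ge0.
apply: (corr_cycle (local := local x) gamma_ge0 s_gt0 k0 A_adj A_swap
  (C_act O1C O2C CPhi) t_ge0 t_step hnorm_act) => // {}c {}g.
- by case.
- by case.
- move=> b' lg; rewrite ladE; apply: local_at_commutator => //.
  by rewrite mulr_ge0.
Qed.

(** The shift makes [Phi] a null vector and leaves the commutators unchanged. *)
Let He := H - E0%:C%:M.

Let He_commutator b :
  commutator He (A b) = \sum_x - commutator (A b) (hloc x).
Proof.
rewrite /commutator mulmxBl mulmxBr scalar_mxC opprB addrA subrK -/(commutator H _).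
by rewrite /H commutator_suml; apply: eq_bigr => x _; rewrite commutatorC.
Qed.

Let h_localN x b : local x (kappa * h) (- commutator (A b) (hloc x)).
Proof.
apply: local_atN; rewrite ladE; apply: local_at_commutator => //.
  by rewrite mulr_ge0.
split; [exact: h_ge0 | exact: h_bounded |].
by move=> b' y yS; apply: commutator_lad => a; apply: h_local.
Qed.

Let corr_sum (F : Lam -> 'M[R[i]]_n) u w :
  corr A Phi (\sum_x F x) u w = \sum_x corr A Phi (F x) u w.
Proof. by rewrite /corr mulmx_suml rdot_sumr. Qed.

Let excess_ge0 b : 0 <= excess A He Phi b M.
Proof.
rewrite /excess mulmxBl rdotBr subr_ge0 mul_scalar_mx rdotZr.
exact: ground_energy_le.
Qed.

(* The excess of the opposite sector is nonnegative, so the sum of the two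
   excesses bounds each of them. *)
Let excess_le b : excess A He Phi b M <=
  M%:R * #|Lam|%:R *
  ((8 * gamma * M%:R ^+ 3 / s ^+ 3 + 2 * kappa * M%:R / s ^+ 2) * (kappa * h) * t M ^+ 2).
Proof.
have He_adj : He^t* = He.
  rewrite /He linearB map_mxB /= (hermsymmxE H_herm) tr_scalar_mx map_scalar_mx.
  by congr (_ - _%:M); exact: conjc_real.
have HePhi : He *m Phi = 0 by rewrite mulmxBl HPhi mul_scalar_mx subrr.
have := excess_ge0 (~~ b); rewrite -(lerDl (excess A He Phi b M)).
rewrite (excess_sum A_adj He_adj HePhi) => /le_trans; apply.
set B := (X in _ <= _ * X); rewrite -mulrA mulr_natl.
have -> : #|Lam|%:R * B *+ M = \sum_(k < M) \sum_(x : Lam) B.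
  by rewrite sumr_const sumr_const card_ord mulr_natl.
apply: ler_sum => k _; rewrite He_commutator !corr_sum -sumrB.
apply: ler_sum => x _; apply: le_trans (ler_norm _) _.
by apply: (cycle _ (h_localN x b)); have := ltn_ord k; lia.
Qed.

Lemma trial_energy b :
  let psi := act A (nseq M b) Phi in
  0 < rdot psi psi /\
  rdot psi (H *m psi) <= (E0 + 2 * (M%:R * #|Lam|%:R *
    ((8 * gamma * M%:R ^+ 3 / s ^+ 3 + 2 * kappa * M%:R / s ^+ 2) * (kappa * h)))) *
    rdot psi psi.
Proof.
move=> psi; set B := _ * (_ * (kappa * h)).
have := moment_nseq_ge O1_herm O2_herm C_herm O1C O2C O1O2 gamma_ge0 CPhi s_gt0 Phi1
  moment1 0 b M.
rewrite add0n -/A -/psi -[moment _ _ _ _ 0 psi]/(rdot psi psi).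
have q0 := (ratio M).1; set q := moment _ _ _ _ _ _ in q0 * => hp.
(* By [small3] the coefficient [s ^+ 2 - gamma * M%:R ^+ 3] in [moment_nseq_ge] is at least half of
   [s ^+ 2]. *)
have qp : q <= 2 * rdot psi psi.
  rewrite -(ler_pM2l (_ : 0 < s ^+ 2)) ?exprn_gt0 //.
  have : 0 <= (s ^+ 2 - 2 * (gamma * M%:R ^+ 3)) * q.
    by rewrite mulr_ge0 ?subr_ge0 // ltW.
  move: hp; set X := rdot psi psi; lra.
split; first by lra.
have B0 : 0 <= B.
  by rewrite /B !(mulr_ge0, addr_ge0) ?invr_ge0 ?exprn_ge0 // ltW.
have tq : t M ^+ 2 = q by rewrite sqr_sqrtr // ltW.
have he := excess_le b.
rewrite /excess mulmxBl rdotBr mul_scalar_mx rdotZr -/psi tq mulrA -/B in he.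
have := ler_wpM2l B0 qp; rewrite mulrDl; move: he.
set X := rdot psi psi; set Y := rdot psi _; lra.
Qed.

End TrialStates.

(** * Constants and conclusion *)

(** A Bernoulli-type induction gives [(1 + x) ^+ k * (1 - k%:R * x) <= 1], whose second factor is at
    least [1 / 2]. *)
Lemma expr_le2 (R : realFieldType) (x : R) k :
  0 <= x -> k%:R * x <= 1 / 2 -> (1 + x) ^+ k <= 2.
Proof.
move=> x0 kx; have h : (1 + x) ^+ k * (1 - k%:R * x) <= 1.
  elim: k {kx} => [|k IHk]; first by rewrite mul0r subr0 mulr1.
  apply: le_trans IHk; rewrite exprSr -mulrA ler_wpM2l ?exprn_ge0 ?addr_ge0 //.
  rewrite -natr1; have : 0 <= (k%:R + 1) * (x * x) by rewrite !mulr_ge0 ?addr_ge0.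
  set y := k%:R; nra.
have p : 0 <= (1 + x) ^+ k by rewrite exprn_ge0 ?addr_ge0.
have : (1 + x) ^+ k * (1 / 2) <= (1 + x) ^+ k * (1 - k%:R * x).
  by rewrite ler_wpM2l //; lra.
by move: h p; set y := (1 + x) ^+ k; lra.
Qed.

Section Constants.
Variables (R : realType) (h o gamma mu N m : R) (r : nat).
Let s := mu * o * N.
Let kappa : R := r%:R * (2 * (2 * o)).

Hypothesis h_gt0 : 0 < h.
Hypothesis o_gt0 : 0 < o.
Hypothesis gamma_gt0 : 0 < gamma.
Hypothesis r_ge2 : (2 <= r)%N.
Hypothesis mu01 : 0 < mu <= 1.
Hypothesis N_gt0 : 0 < N.
Hypothesis m_ge1 : 1 <= m.
Hypothesis m_le : m ^+ 2 / N <=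
  Num.min (mu ^+ 2 / (192 * r%:R)) (o * mu / Num.sqrt (24 * gamma)).

Let mu_gt0 : 0 < mu. Proof. by case/andP: mu01. Qed.
Let mu_le1 : mu <= 1. Proof. by case/andP: mu01. Qed.
Let r2 : 2 <= r%:R :> R. Proof. by rewrite ler_nat. Qed.

Let m_ge0 : 0 <= m. Proof. exact: le_trans ler01 m_ge1. Qed.

Lemma sqr_le_volume : m ^+ 2 * (192 * r%:R) <= mu ^+ 2 * N.
Proof.
move: m_le; rewrite le_min => /andP[+ _].
rewrite ler_pdivrMr // mulrAC ler_pdivlMr; first exact.
by rewrite mulr_gt0 // ltr0n (leq_trans _ r_ge2).
Qed.

Lemma quartic_le_order : 24 * (gamma * m ^+ 4) <= s ^+ 2.
Proof.
move: m_le; rewrite le_min => /andP[_].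
have g : 0 < 24 * gamma by rewrite mulr_gt0.
rewrite ler_pdivrMr // mulrAC ler_pdivlMr ?sqrtr_gt0 // => le.
have -> : 24 * (gamma * m ^+ 4) = (m ^+ 2 * Num.sqrt (24 * gamma)) ^+ 2.
  by rewrite exprMn sqr_sqrtr ?ltW // -exprM; ring.
have oN : 0 <= o * mu * N by rewrite !mulr_ge0 // ltW.
have mS : 0 <= m ^+ 2 * Num.sqrt (24 * gamma) by rewrite mulr_ge0 ?sqr_ge0 ?sqrtr_ge0.
by rewrite /s (mulrC mu o) ler_pXn2r ?nnegrE.
Qed.

Lemma cubic_le_order : 2 * (gamma * m ^+ 3) <= s ^+ 2.
Proof.
apply: le_trans quartic_le_order.
have : gamma * m ^+ 3 <= gamma * m ^+ 4.
  by rewrite ler_wpM2l ?(ltW gamma_gt0) // ler_weXn2l.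
have : 0 <= gamma * m ^+ 3 by rewrite mulr_ge0 ?exprn_ge0 ?(ltW gamma_gt0).
lra.
Qed.

(** Since [kappa / s] is [4 * r / (mu * N)], the bounds [m <= m ^+ 2] and [mu ^+ 2 <= mu] reduce
    this to [sqr_le_volume]. *)
Lemma small_step : 2 * m * (kappa / s) <= 1 / 2.
Proof.
have -> : kappa / s = 4 * r%:R / (mu * N) by rewrite /kappa /s; field; rewrite !gt_eqF.
rewrite mulrA ler_pdivrMr ?mulr_gt0 //.
have mm : m <= m ^+ 2 by rewrite expr2 ler_peMl.
have h1 : m * r%:R <= m ^+ 2 * r%:R by rewrite ler_wpM2r.
have h2 : mu ^+ 2 * N <= mu * N.
  by rewrite ler_wpM2r ?(ltW N_gt0) // expr2 ler_piMl // ltW.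
have := sqr_le_volume; have : 0 <= m * r%:R by rewrite mulr_ge0.
lra.
Qed.

(** The two terms scale as [(m ^+ 2 / N) ^+ 2] and [m ^+ 2 / N]; as [m ^+ 2 <= N], the first is
    absorbed into the second. *)
Lemma energy_constant :
  2 * (m * N * ((8 * gamma * m ^+ 3 / s ^+ 3 + 2 * kappa * m / s ^+ 2) * (kappa * h)))
  <= 2 * kappa * h * (8 * gamma / (mu * o) ^+ 3 + 2 * kappa / (mu * o) ^+ 2) *
     (m ^+ 2 / N).
Proof.
have mN : m ^+ 2 <= N.
  have h1 : m ^+ 2 <= m ^+ 2 * (192 * r%:R).
    by rewrite ler_peMr ?sqr_ge0 //; have := r2; lra.
  apply: le_trans h1 (le_trans sqr_le_volume _).
  by rewrite ler_piMl ?(ltW N_gt0) // expr_le1 // ltW.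
have k0 : 0 <= kappa by rewrite /kappa !mulr_ge0 // ltW.
have -> : 2 * (m * N * ((8 * gamma * m ^+ 3 / s ^+ 3 + 2 * kappa * m / s ^+ 2) *
    (kappa * h))) =
  2 * kappa * h * (8 * gamma / (mu * o) ^+ 3 * (m ^+ 2 / N) +
    2 * kappa / (mu * o) ^+ 2) * (m ^+ 2 / N).
  by rewrite /s; field; rewrite !gt_eqF.
have mN0 : 0 <= m ^+ 2 / N by rewrite divr_ge0 ?sqr_ge0 // ltW.
apply: (ler_wpM2r mN0); apply: ler_wpM2l; first by rewrite !mulr_ge0 // ltW.
rewrite lerD2r; apply: ler_piMr.
  by rewrite divr_ge0 ?mulr_ge0 ?exprn_ge0 ?mulr_ge0 // ltW.
by rewrite ler_pdivrMr // mul1r.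
Qed.

End Constants.

Lemma signed_abszE (M : int) : (if 0 < M then `|M|%N%:Z else - `|M|%N%:Z) = M.
Proof. by case: ltrP => ?; lia. Qed.

Lemma inner_eigen_eq0 (R : realType) n (C : 'M[R[i]]_n) u v (a b : R) :
  C \is hermsymmx -> C *m u = a%:C *: u -> C *m v = b%:C *: v -> a != b ->
  inner u v = 0.
Proof.
move=> hC Cu Cv ab; have := inner_mulmx C u v.
rewrite hermsymmxE // Cu Cv innerZr => e.
have {e} : b%:C * inner u v = a%:C * inner u v.
  rewrite e innerC innerZr [LHS]rmorphM [inner u v]innerC; congr (_ * _).
  exact: conjc_real.
move=> /eqP; rewrite -subr_eq0 -mulrBl -rmorphB mulf_eq0.
case/orP => [|/eqP //]; rewrite -[0]/(0%:C) => /eqP/complexI/eqP.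
by rewrite subr_eq0 eq_sym (negPf ab).
Qed.

Theorem corollary11 (R : realType) (h o gamma mu : R) (r : nat) :
  0 < h -> 0 < o -> 0 < gamma -> (2 <= r)%N -> 0 < mu <= 1 ->
  exists c3 : R,
  forall (Lam : finType) (d : Lam -> nat)
    (hloc : Lam -> 'M[R[i]]_(tensor_dim d))
    (oloc : 'I_2 -> Lam -> 'M[R[i]]_(tensor_dim d))
    (C : 'M[R[i]]_(tensor_dim d))
    (E0 : R) (Phi0 : 'cV[R[i]]_(tensor_dim d)),
  let N : R := #|Lam|%:R in
  let H : 'M[R[i]]_(tensor_dim d) := \sum_x hloc x in
  let O1 : 'M[R[i]]_(tensor_dim d) := \sum_x oloc 0 x in
  let O2 : 'M[R[i]]_(tensor_dim d) := \sum_x oloc 1 x in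
  let U := mxexp ((0 +i* (pi / Num.sqrt gamma)) *: O1) in
  let c2 : R := Num.min (mu ^+ 2 / (192 * r%:R))
                        (o * mu / Num.sqrt (24 * gamma)) in
  (0 < #|Lam|)%N ->
  (forall x, hloc x \is hermsymmx) ->
  (forall a x, oloc a x \is hermsymmx) ->
  C \is hermsymmx ->
  commutator H C = 0 ->
  commutator O1 C = - (0 +i* 1) *: O2 ->
  commutator O2 C = (0 +i* 1) *: O1 ->
  (* ground state *)
  ground_energy H E0 ->
  eigenstate H E0%:C Phi0 ->
  hnorm Phi0 = 1 ->
  (exists c : R[i], eigenstate C c Phi0) ->
  (* i *)
  (forall a b x y, x != y -> commutator (oloc a x) (oloc b y) = 0) ->
  (* ii *)
  (exists S : Lam -> {set Lam}, forall x,
     (#|S x| <= r)%N /\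
     forall a y, y \notin S x -> commutator (hloc x) (oloc a y) = 0) ->
  (* iii *)
  (forall x, opnorm (hloc x) <= h) ->
  (forall a x, opnorm (oloc a x) <= o) ->
  (* iv *)
  inner Phi0 (O1 *m O1 *m Phi0) = inner Phi0 (O2 *m O2 *m Phi0) ->
  ((mu * o * N) ^+ 2)%:C <= inner Phi0 (O1 *m O1 *m Phi0) ->
  (* v *)
  commutator O1 O2 = (0 +i* gamma) *: C ->
  (* vi *)
  U *m H *m invmx U = H ->
  (exists z : R[i], U *m Phi0 = z *: Phi0) ->
  exists (Phi : int -> 'cV[R[i]]_(tensor_dim d)) (E : int -> R),
    (forall M : int, M != 0 -> M%:~R ^+ 2 / N <= c2 ->
       [/\ eigenstate H (E M)%:C (Phi M),
           inner (Phi M) Phi0 = 0 &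
           E M - E0 <= c3 * (M%:~R ^+ 2 / N)]) /\
    (forall M M' : int, M != 0 -> M%:~R ^+ 2 / N <= c2 ->
       M' != 0 -> M'%:~R ^+ 2 / N <= c2 ->
       M != M' -> inner (Phi M) (Phi M') = 0).
Proof.
move=> h0 o0 g0 r2 mu01; pose kappa : R := r%:R * (2 * (2 * o)).
(* The constant of [energy_constant], with [mu * o * N] as the order scale [s]. *)
exists (2 * kappa * h * (8 * gamma / (mu * o) ^+ 3 + 2 * kappa / (mu * o) ^+ 2)).
move=> Lam d hloc oloc C E0 Phi0 N H O1 O2 U c2 Lam0 hh ho hC HC O1C O2C gE.
move=> [Phi0n HPhi] Phi1 [c [_ CPhic]] ocomm [S hS] hb ob oeq oge O1O2 _ [z Uz].
have mu0 : 0 < mu by case/andP: mu01.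
have N0 : 0 < N by rewrite ltr0n.
have s0 : 0 < mu * o * N by rewrite !mulr_gt0.
have herm_sum (F : Lam -> 'M[R[i]]_(tensor_dim d)) :
    (forall x, F x \is hermsymmx) -> \sum_x F x \is hermsymmx.
  move=> hF; apply/is_hermitianmxP; rewrite expr0 scale1r trmxC_sum.
  by apply: eq_bigr => x _; rewrite hermsymmxE.
have O1h : O1 \is hermsymmx := herm_sum _ (ho 0).
have O2h : O2 \is hermsymmx := herm_sum _ (ho 1).
have Hh : H \is hermsymmx := herm_sum _ hh.
have CPhi : C *m Phi0 = 0.
  suff c0 : c = 0 by rewrite CPhic c0 scale0r.
  apply: (half_turn_eigenvalue0 g0 O1h _ Uz Phi0n CPhic).
  (* The relations for [[O1, C]] and [[O1, O2]] combine into [[O1, [O1, C]] = gamma C]. *)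
  rewrite O1C /commutator -scalemxAl -scalemxAr -scalerBr -/(commutator O1 O2) O1O2.
  rewrite scalerA; congr (_ *: _).
  by apply/eqP; rewrite eq_complex /=; apply/andP; split; apply/eqP; ring.
have Phi1' : rdot Phi0 Phi0 = 1 by rewrite -sqr_hnorm Phi1 expr1n.
have order : (mu * o * N) ^+ 2 <= rdot Phi0 (O1 *m O1 *m Phi0).
  by move: oge; rewrite lecE => /andP[].
(* The conditions on [M] stand under the existential, so that [choice] yields total functions;
   excluded [M] receive the dummy pair [(0, 0)]. *)
have ex (M : int) : exists p : R * 'cV[R[i]]_(tensor_dim d),
    M != 0 -> M%:~R ^+ 2 / N <= c2 ->
    [/\ eigenstate H (p.1)%:C p.2, C *m p.2 = (M%:~R)%:C *: p.2 &
      p.1 - E0 <= 2 * kappa * h * (8 * gamma / (mu * o) ^+ 3 +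
        2 * kappa / (mu * o) ^+ 2) * (M%:~R ^+ 2 / N)].
  have [M0|] := eqVneq M 0; first by exists (0, 0); rewrite M0.
  move=> M0; have [Mc2|Mc2] := boolP (M%:~R ^+ 2 / N <= c2); last first.
    by exists (0, 0) => _ le; case/negP: Mc2.
  (* Positive [M] uses raising letters, negative [M] lowering ones. *)
  set m := `|M|%N; set b := 0 < M.
  have mM : m%:R ^+ 2 = M%:~R ^+ 2 :> R.
    by rewrite /m natr_absz intr_norm real_normK ?num_real.
  have m1 : 1 <= m%:R :> R by rewrite ler1n absz_gt0.
  have mc2 : m%:R ^+ 2 / N <= c2 by rewrite mM.
  have small : (1 + kappa / (mu * o * N)) ^+ m.*2 <= 2.
    have k0 : 0 <= kappa := mulr_ge0 (ler0n _ _) (mulr_ge0 (ler0n _ 2) (mulr_ge0 (ler0n _ 2) (ltW o0))).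
    apply: expr_le2 (divr_ge0 k0 (ltW s0)) _.
    rewrite -mul2n natrM.
    exact: (small_step o0 r2 mu01 N0 m1 mc2).
  have [p0 le] := trial_energy (S := S) (ltW h0) (ltW o0) (ltW g0) s0 Hh O1h O2h hC O1C O2C
    O1O2 gE HPhi Phi1' CPhi ocomm (fun x => (hS x).1) (fun x a y => (hS x).2 a y)
    (fun x => opnorm_bounded (hb x)) (fun a x => opnorm_bounded (ob a x)) order small
    (cubic_le_order o0 g0 mu01 N0 m1 mc2) b.
  set psi := act _ _ _ in p0 le.
  have psi0 : psi != 0.
    by apply: contraTneq p0 => ->; rewrite /rdot /inner mulmx0 mxE ltxx.
  have Cpsi : C *m psi = (M%:~R)%:C *: psi.
    rewrite /psi (C_act O1C O2C CPhi) weight_nseq; congr ((_%:~R)%:C *: _).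
    exact: signed_abszE.
  have [E [v [Ev Cv Ele]]] := rayleigh_eigenstate Hh HC psi0 Cpsi.
  exists (E, v) => _ _; split; [exact: Ev | exact: Cv |].
  have := le_trans Ele le; rewrite ler_pM2r // -mM lerBlDl => {}le.
  apply: le_trans le _; rewrite lerD2l.
  exact: (energy_constant h0 o0 g0 r2 mu01 N0 mc2).
have [f hf] := choice ex.
exists (fun M => (f M).2), (fun M => (f M).1); split.
  move=> M M0 Mc2; have [Ev Cv Ele] := hf M M0 Mc2; split=> //.
  (* Orthogonality comes from distinct eigenvalues of [C], here [M] against 0. *)
  have C0 : C *m Phi0 = 0%:C *: Phi0 by rewrite CPhi scale0r.
  by apply: inner_eigen_eq0 hC Cv C0 _; rewrite intr_eq0.
move=> M M' M0 Mc2 M0' Mc2' MM'.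
have [_ Cv _] := hf M M0 Mc2; have [_ Cv' _] := hf M' M0' Mc2'.
by apply: inner_eigen_eq0 hC Cv Cv' _; rewrite eqr_int.
Qed.
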